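(* Let $\Bbbk$ be a field, $\mathcal C$ a $\Bbbk$-linear monoidal category and $\mathbf M,\mathbf N$ cyclic $\mathcal C$-module categories. Choose a cyclic generator $X$ for $\mathbf M$ and a cyclic generator $Y$ for $\mathbf N$. Then $\mathbf M$ and $\mathbf N$ are equivalent as $\mathcal C$-module categories if and only if the monoid objects $[X,X]$ and $[Y,Y]$ in $\mathcal C\text{-Tamb}(\mathcal C,\mathcal C)$ are Morita equivalent.
   Context: All categories, functors, etc. are $\Bbbk$-linear; $FG$ abbreviates $F\otimes G$ in $\mathcal C$. A $\mathcal C$-module category is a category $\mathbf M$ with a strong monoidal functor $\mathcal C\to\mathrm{End}(\mathbf M)$, $F\mapsto\mathbf MF$, with coherence isomorphisms $\mathbf m_{G,F}:\mathbf MG\,\mathbf MF\Rightarrow\mathbf M(GF)$, $\mathbf m_{\mathbb 1}:\mathrm{Id}_{\mathbf M}\Rightarrow\mathbf M\mathbb 1$. A $\mathcal C$-module functor is a functor $\Phi$ with coherent natural isomorphisms $\mathbf NF\,\Phi\Rightarrow\Phi\,\mathbf MF$; equivalence of module categories is equivalence via such functors. A Cauchy complete (i.e. additive and idempotent split) $\mathcal C$-module category $\mathbf M$ is cyclic, with cyclic generator $X\in\mathbf M$, if every object of $\mathbf M$ is a direct summand of a finite direct sum of objects of the form $\mathbf MF\,X$, $F\in\mathcal C$. $\mathcal C\text{-Tamb}(\mathcal C,\mathcal C)$ is the category of (classical) Tambara modules: functors $\mathtt\Phi:\mathcal C^{\mathrm{op}}\otimes_\Bbbk\mathcal C\to\mathbf{Vec}_\Bbbk$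 with linear maps $\mathsf t_{H;F,G}:\mathtt\Phi(F,G)\to\mathtt\Phi(HF,HG)$, natural in $F,G$, extranatural in $H$, and compatible with associators and unitors (i.e. $\mathsf t_{KH}$ agrees with $\mathsf t_K\circ\mathsf t_H$, and $\mathsf t_{\mathbb 1}$ with the identity, up to the coherence isomorphisms of $\mathcal C$); morphisms are natural transformations commuting with the $\mathsf t$'s. It is monoidal under $(\mathtt\Psi\diamond\mathtt\Phi)(F,G)=\int^{H}\mathtt\Psi(F,H)\otimes_\Bbbk\mathtt\Phi(H,G)$ (Tambara structure induced by $\mathsf t^{\mathtt\Psi}\otimes\mathsf t^{\mathtt\Phi}$), with unit $\mathcal C(-,-)$; it has reflexive coequalizers preserved by $\diamond$ in each variable, so relative tensor products of bimodules are defined. For $X\in\mathbf M$, $[X,X]$ is the Tambara module $(F,G)\mapsto\mathrm{Hom}_{\mathbf M}(\mathbf MFX,\mathbf MGX)$ with structure $f\mapsto(\mathbf m_{H,G})_X\circ\mathbf MH(f)\circ(\mathbf m_{H,F})_X^{-1}$; it is a monoid with unit $\mathcal C(F,G)\ni f\mapsto(\mathbf Mf)_X$ and multiplication $b\otimes c\mapsto c\circ b$. Monoids $A,B$ are Morita equivalent if there are an $A$-$B$-bimodule $M$ and a $B$-$A$-bimodule $N$ with $M\otimes_BN\cong A$ as $A$-$A$-bimodules and $N\otimes_AM\cong B$ as $B$-$B$-bimodules. *)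

(* Defs.v *)
From HB Require Import structures.
From mathcomp Require Import all_boot all_algebra.
From mathcomp Require Import boolp.

Set Implicit Arguments.
Unset Strict Implicit.
Unset Printing Implicit Defensive.

Import GRing.Theory.
Local Open Scope ring_scope.
Local Open Scope quotient_scope.

Definition mklinear (k : fieldType) (U V : lmodType k) (f : U -> V)
    (fL : linear f) : {linear U -> V} :=
  HB.pack f (GRing.isLinear.Build k U V *:%R f fL).

Lemma mklinearE (k : fieldType) (U V : lmodType k) (f : U -> V)
  (fL : linear f) x : mklinear fL x = f x.
Proof. by []. Qed.

Section Presentation.

Variables (k : fieldType) (T : Type).

Inductive lterm : Type :=
| LGen of T
| LZero
| LAdd of lterm & lterm
| LScale of k & lterm.

HB.instance Definition _ := gen_eqMixin lterm.
HB.instance Definition _ := gen_choiceMixin lterm.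

Fixpoint leval (V : lmodType k) (f : T -> V) (s : lterm) : V :=
  match s with
  | LGen t => f t
  | LZero => 0
  | LAdd s1 s2 => leval f s1 + leval f s2
  | LScale c s1 => c *: leval f s1
  end.

Variable R : lterm -> lterm -> Prop.

Definition lsat (V : lmodType k) (f : T -> V) : Prop :=
  forall s t, R s t -> leval f s = leval f t.

(* Being identified in the presented space means being equal in every vector
   space in which the relations hold. *)
Definition lequiv (s t : lterm) : bool :=
  `[< forall (V : lmodType k) (f : T -> V), lsat f -> leval f s = leval f t >].

Lemma lequiv_refl : reflexive lequiv.
Proof. by move=> s; apply/asboolP. Qed.

Lemma lequiv_sym : symmetric lequiv.
Proof.
by move=> s t; apply/asboolP/asboolP => h V f fP; rewrite (h V f fP).
Qed.

Lemma lequiv_trans : transitive lequiv.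
Proof.
move=> t s u /asboolP h1 /asboolP h2; apply/asboolP => V f fP.
by rewrite (h1 V f fP) (h2 V f fP).
Qed.

Canonical lequiv_equiv := EquivRel lequiv lequiv_refl lequiv_sym lequiv_trans.

Definition pres : Type := {eq_quot lequiv}.
HB.instance Definition _ := Choice.on pres.

Let cls (s : lterm) : pres := \pi_{eq_quot lequiv} s.

Lemma clsP s t :
  (forall (V : lmodType k) (f : T -> V), lsat f -> leval f s = leval f t) ->
  cls s = cls t.
Proof. by move=> h; apply/eqmodP/asboolP. Qed.

Lemma cls_ind (P : pres -> Prop) : (forall s, P (cls s)) -> forall x, P x.
Proof. by move=> h x; rewrite -[x]reprK; exact: h. Qed.

Lemma leval_repr s (V : lmodType k) (f : T -> V) :
  lsat f -> leval f (repr (cls s)) = leval f s.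
Proof.
move=> fP; have /eqmodP/asboolP h : repr (cls s) = s %[mod {eq_quot lequiv}].
  exact: reprK.
exact: h.
Qed.

Definition pres_add (x y : pres) : pres := cls (LAdd (repr x) (repr y)).
Definition pres_opp (x : pres) : pres := cls (LScale (-1) (repr x)).
Definition pres_scale (c : k) (x : pres) : pres := cls (LScale c (repr x)).

Lemma pres_addA : associative pres_add.
Proof.
move=> x y z; apply: clsP => V f fP /=.
by rewrite !(leval_repr _ fP) /= addrA.
Qed.

Lemma pres_addC : commutative pres_add.
Proof. by move=> x y; apply: clsP => V f fP /=; rewrite addrC. Qed.

Lemma pres_add0 : left_id (cls LZero) pres_add.
Proof.
elim/cls_ind=> s; apply: clsP => V f fP /=.
by rewrite !(leval_repr _ fP) /= add0r.
Qed.

Lemma pres_addN : left_inverse (cls LZero) pres_opp pres_add.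
Proof.
move=> x; apply: clsP => V f fP /=.
by rewrite !(leval_repr _ fP) /= scaleN1r addNr.
Qed.

HB.instance Definition _ :=
  GRing.isZmodule.Build pres pres_addA pres_addC pres_add0 pres_addN.

Lemma pres_scaleA a b x :
  pres_scale a (pres_scale b x) = pres_scale (a * b) x.
Proof.
apply: clsP => V f fP /=.
by rewrite !(leval_repr _ fP) /= scalerA.
Qed.

Lemma pres_scale1 : left_id 1 pres_scale.
Proof.
elim/cls_ind=> s; apply: clsP => V f fP /=.
by rewrite !(leval_repr _ fP) /= scale1r.
Qed.

Lemma pres_scaleDr : right_distributive pres_scale +%R.
Proof.
move=> a x y; apply: clsP => V f fP /=.
by rewrite !(leval_repr _ fP) /= scalerDr.
Qed.

Lemma pres_scaleDl x : {morph pres_scale^~ x : a b / a + b}.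
Proof.
move=> a b; apply: clsP => V f fP /=.
by rewrite !(leval_repr _ fP) /= scalerDl.
Qed.

HB.instance Definition _ := GRing.Zmodule_isLmodule.Build k pres
  pres_scaleA pres_scale1 pres_scaleDr pres_scaleDl.

Definition gen (t : T) : pres := cls (LGen t).

Lemma leval_gen s : leval gen s = cls s.
Proof.
elim: s => [t||s IHs t IHt|c s IHs] //=.
- rewrite IHs IHt; apply: clsP => V f fP /=.
  by rewrite !(leval_repr _ fP).
- by rewrite IHs; apply: clsP => V f fP /=; rewrite !(leval_repr _ fP).
Qed.

Lemma gen_sat : lsat gen.
Proof. by move=> s t sRt; rewrite !leval_gen; apply: clsP => V f; apply. Qed.

Definition pres_lift_fun (V : lmodType k) (f : T -> V) (x : pres) : V :=
  leval f (repr x).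

Lemma pres_lift_linear (V : lmodType k) (f : T -> V) :
  lsat f -> linear (pres_lift_fun f).
Proof.
move=> fP c x y; rewrite /pres_lift_fun.
by rewrite (leval_repr _ fP) /= (leval_repr _ fP).
Qed.

Definition pres_lift (V : lmodType k) (f : T -> V) (fP : lsat f) :
  {linear pres -> V} := mklinear (pres_lift_linear fP).

Lemma pres_liftE (V : lmodType k) (f : T -> V) (fP : lsat f) t :
  pres_lift fP (gen t) = f t.
Proof. by rewrite /= /pres_lift_fun (leval_repr _ fP). Qed.

Lemma pres_ext (V : lmodType k) (f g : {linear pres -> V}) :
  (forall t, f (gen t) = g (gen t)) -> forall x, f x = g x.
Proof.
move=> fg; elim/cls_ind=> s; rewrite -leval_gen.
elim: s => [t||s IHs t IHt|c s IHs] /=; first exact: fg.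
- by rewrite !linear0.
- by rewrite !linearD IHs IHt.
- by rewrite !linearZ /= IHs.
Qed.

End Presentation.

#[local] Obligation Tactic := idtac.

Section Categories.

Variable k : fieldType.

Record lincat : Type := LinCat {
  ob :> Type;
  hom : ob -> ob -> lmodType k;
  idm : forall a, hom a a;
  comp : forall a b c, hom b c -> hom a b -> hom a c;
  comp1m : forall a b (f : hom a b), comp (idm b) f = f;
  compm1 : forall a b (f : hom a b), comp f (idm a) = f;
  compA : forall a b c d (h : hom c d) (g : hom b c) (f : hom a b),
    comp h (comp g f) = comp (comp h g) f;
  comp_linl : forall a b c (f : hom a b), linear (fun g : hom b c => comp g f);
  comp_linr : forall a b c (g : hom b c), linear (fun f : hom a b => comp g f)
}.

End Categories.

Arguments hom {k l} a b.
Arguments idm {k l} a.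
Arguments comp {k l a b c} g f.

Notation "g \oc f" := (comp g f) (at level 40, left associativity).

Section CategoryNotions.

Variable k : fieldType.

Record iso (C : lincat k) (a b : C) : Type := Iso {
  fwd : hom a b;
  bwd : hom b a;
  bwdK : bwd \oc fwd = idm a;
  fwdK : fwd \oc bwd = idm b
}.

Record functor (C D : lincat k) : Type := Functor {
  fob :> C -> D;
  fmap : forall a b, {linear hom a b -> hom (fob a) (fob b)};
  fmap_id : forall a, fmap a a (idm a) = idm (fob a);
  fmap_comp : forall a b c (g : hom b c) (f : hom a b),
    fmap a c (g \oc f) = fmap b c g \oc fmap a b f
}.

End CategoryNotions.

Arguments fmap {k C D} _ {a b}.
Arguments fmap_id {k C D} _ a.
Arguments fmap_comp {k C D} _ {a b c} _ _.

Section Functors.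

Variable k : fieldType.

Lemma id_functor_subproof (C : lincat k) (a b : C) :
  linear (fun f : hom a b => f).
Proof. by []. Qed.

Definition id_functor (C : lincat k) : functor C C :=
  @Functor k C C (fun a => a) (fun a b => mklinear (@id_functor_subproof C a b))
    (fun a => erefl) (fun a b c g f => erefl).

Section Comp.

Variables (C D E : lincat k) (G : functor D E) (F : functor C D).

Lemma comp_functor_linear a b :
  linear (fun f : hom a b => fmap G (fmap F f)).
Proof. by move=> c f g; rewrite !linearP. Qed.

Lemma comp_functor_id a : mklinear (@comp_functor_linear a a) (idm a) = idm _.
Proof. by rewrite /= !fmap_id. Qed.

Lemma comp_functor_comp a b c (g : hom b c) (f : hom a b) :
  mklinear (@comp_functor_linear a c) (g \oc f) =
  mklinear (@comp_functor_linear b c) g \oc mklinear (@comp_functor_linear a b) f.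
Proof. by rewrite /= !fmap_comp. Qed.

Definition comp_functor : functor C E :=
  Functor comp_functor_id comp_functor_comp.

End Comp.

Record natiso (C D : lincat k) (F G : functor C D) : Type := NatIso {
  niso : forall a, iso (F a) (G a);
  niso_nat : forall a b (f : hom a b),
    fwd (niso b) \oc fmap F f = fmap G f \oc fwd (niso a)
}.

Definition is_equivalence (C D : lincat k) (F : functor C D) : Prop :=
  exists G : functor D C,
    inhabited (natiso (comp_functor G F) (id_functor C)) /\
    inhabited (natiso (comp_functor F G) (id_functor D)).

Variable C : lincat k.

Definition is_direct_sum (n : nat) (Z : 'I_n -> C) (S : C) : Prop :=
  exists (i : forall j, hom (Z j) S) (p : forall j, hom S (Z j)),
    [/\ forall j, p j \oc i j = idm (Z j),
        forall j l, j != l -> p j \oc i l = 0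
      & \sum_(j < n) i j \oc p j = idm S].

Definition is_direct_summand (Z S : C) : Prop :=
  exists (i : hom Z S) (p : hom S Z), p \oc i = idm Z.

(* The case n = 0 provides a zero object. *)
Definition additive_cat : Prop :=
  forall (n : nat) (Z : 'I_n -> C), exists S, is_direct_sum Z S.

Definition idempotent_split : Prop :=
  forall (a : C) (e : hom a a), e \oc e = e ->
    exists (b : C) (i : hom b a) (p : hom a b), p \oc i = idm b /\ i \oc p = e.

Definition cauchy_complete : Prop := additive_cat /\ idempotent_split.

End Functors.

Section Monoidal.

Variable k : fieldType.

Record moncat : Type := MonCat {
  mc_cat :> lincat k;
  ten : mc_cat -> mc_cat -> mc_cat;
  tenm : forall F F' G G' : mc_cat,
    hom F F' -> hom G G' -> hom (ten F G) (ten F' G');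
  tenm_id : forall F G, tenm (idm F) (idm G) = idm (ten F G);
  tenm_comp : forall F F' F'' G G' G'' (f' : hom F' F'') (f : hom F F')
      (g' : hom G' G'') (g : hom G G'),
    tenm (f' \oc f) (g' \oc g) = tenm f' g' \oc tenm f g;
  tenm_linl : forall F F' G G' (g : hom G G'),
    linear (fun f : hom F F' => tenm f g);
  tenm_linr : forall F F' G G' (f : hom F F'),
    linear (fun g : hom G G' => tenm f g);
  one : mc_cat;
  assoc : forall F G H, iso (ten (ten F G) H) (ten F (ten G H));
  assoc_nat : forall F F' G G' H H'
      (f : hom F F') (g : hom G G') (h : hom H H'),
    fwd (assoc F' G' H') \oc tenm (tenm f g) h =
    tenm f (tenm g h) \oc fwd (assoc F G H);
  lunit : forall F, iso (ten one F) F;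
  lunit_nat : forall F F' (f : hom F F'),
    fwd (lunit F') \oc tenm (idm one) f = f \oc fwd (lunit F);
  runit : forall F, iso (ten F one) F;
  runit_nat : forall F F' (f : hom F F'),
    fwd (runit F') \oc tenm f (idm one) = f \oc fwd (runit F);
  pentagon : forall F G H K,
    fwd (assoc F G (ten H K)) \oc fwd (assoc (ten F G) H K) =
    tenm (idm F) (fwd (assoc G H K)) \oc fwd (assoc F (ten G H) K)
      \oc tenm (fwd (assoc F G H)) (idm K);
  triangle : forall F G,
    tenm (idm F) (fwd (lunit G)) \oc fwd (assoc F one G) =
    tenm (fwd (runit F)) (idm G)
}.

End Monoidal.

Arguments ten {k m} F G.
Arguments tenm {k m F F' G G'} f g.
Arguments one {k m}.
Arguments assoc {k m} F G H.
Arguments lunit {k m} F.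
Arguments runit {k m} F.

Notation "F \ot G" := (ten F G) (at level 30, right associativity).
Notation "f \otm g" := (tenm f g) (at level 30, right associativity).

Section ModuleCategories.

Variables (k : fieldType) (C : moncat k).

Record modcat : Type := ModCat {
  mod_cat :> lincat k;
  act : C -> functor mod_cat mod_cat;
  actm : forall (F G : C) (X : mod_cat), {linear hom F G -> hom (act F X) (act G X)};
  actm_nat : forall (F G : C) (f : hom F G) (X Y : mod_cat) (u : hom X Y),
    actm F G Y f \oc fmap (act F) u = fmap (act G) u \oc actm F G X f;
  actm_id : forall (F : C) X, actm F F X (idm F) = idm (act F X);
  actm_comp : forall (F G H : C) (g : hom G H) (f : hom F G) X,
    actm F H X (g \oc f) = actm G H X g \oc actm F G X f;
  mten : forall (G F : C) (X : mod_cat), iso (act G (act F X)) (act (G \ot F) X);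
  mten_nat : forall (G F : C) (X Y : mod_cat) (u : hom X Y),
    fwd (mten G F Y) \oc fmap (act G) (fmap (act F) u) =
    fmap (act (G \ot F)) u \oc fwd (mten G F X);
  mten_natm : forall (G G' F F' : C) (g : hom G G') (f : hom F F') (X : mod_cat),
    fwd (mten G' F' X)
      \oc (actm G G' (act F' X) g \oc fmap (act G) (actm F F' X f)) =
    actm (G \ot F) (G' \ot F') X (g \otm f) \oc fwd (mten G F X);
  mone : forall X : mod_cat, iso X (act one X);
  mone_nat : forall (X Y : mod_cat) (u : hom X Y),
    fwd (mone Y) \oc u = fmap (act one) u \oc fwd (mone X);
  mten_assoc : forall (H G F : C) (X : mod_cat),
    fwd (mten H (G \ot F) X) \oc fmap (act H) (fwd (mten G F X)) =
    actm _ _ X (fwd (assoc H G F)) \oc fwd (mten (H \ot G) F X)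
      \oc fwd (mten H G (act F X));
  mten_lunit : forall (F : C) (X : mod_cat),
    actm _ _ X (fwd (lunit F)) \oc fwd (mten one F X) \oc fwd (mone (act F X)) =
    idm (act F X);
  mten_runit : forall (F : C) (X : mod_cat),
    actm _ _ X (fwd (runit F)) \oc fwd (mten F one X)
      \oc fmap (act F) (fwd (mone X)) =
    idm (act F X)
}.

End ModuleCategories.

Arguments act {k C m} F.
Arguments actm {k C m F G} X.
Arguments mten {k C m} G F X.
Arguments mone {k C m} X.

Section ModuleFunctors.

Variables (k : fieldType) (C : moncat k).

Record modfunctor (M N : modcat C) : Type := ModFunctor {
  mf_functor :> functor M N;
  mf_iso : forall (F : C) (X : M), iso (act F (mf_functor X)) (mf_functor (act F X));
  mf_nat : forall (F : C) (X Y : M) (u : hom X Y),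
    fwd (mf_iso F Y) \oc fmap (act F) (fmap mf_functor u) =
    fmap mf_functor (fmap (act F) u) \oc fwd (mf_iso F X);
  mf_natm : forall (F G : C) (f : hom F G) (X : M),
    fwd (mf_iso G X) \oc actm (mf_functor X) f =
    fmap mf_functor (actm X f) \oc fwd (mf_iso F X);
  mf_ten : forall (G F : C) (X : M),
    fwd (mf_iso (G \ot F) X) \oc fwd (mten G F (mf_functor X)) =
    fmap mf_functor (fwd (mten G F X)) \oc fwd (mf_iso G (act F X))
      \oc fmap (act G) (fwd (mf_iso F X));
  mf_one : forall X : M,
    fwd (mf_iso one X) \oc fwd (mone (mf_functor X)) =
    fmap mf_functor (fwd (mone X))
}.

Definition modcat_equivalent (M N : modcat C) : Prop :=
  exists Phi : modfunctor M N, is_equivalence Phi.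

Definition is_cyclic_generator (M : modcat C) (X : M) : Prop :=
  forall Z : M, exists (n : nat) (F : 'I_n -> C) (S : M),
    is_direct_sum (fun j => act (F j) X) S /\ is_direct_summand Z S.

End ModuleFunctors.

Section Tambara.

Variables (k : fieldType) (C : moncat k).

(* A functor on the k-linear tensor product of C^op and C is a functor of two
   variables that is k-linear in each. *)
Record tambara : Type := Tambara {
  tval :> C -> C -> lmodType k;
  tmap : forall F F' G G', hom F' F -> hom G G' ->
    {linear tval F G -> tval F' G'};
  tmap_linl : forall F F' G G' (g : hom G G') (x : tval F G),
    linear (fun f : hom F' F => tmap f g x);
  tmap_linr : forall F F' G G' (f : hom F' F) (x : tval F G),
    linear (fun g : hom G G' => tmap f g x);
  tmap_id : forall F G (x : tval F G), tmap (idm F) (idm G) x = x;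
  tmap_comp : forall F F' F'' G G' G'' (f : hom F' F) (f' : hom F'' F')
      (g' : hom G' G'') (g : hom G G') (x : tval F G),
    tmap (f \oc f') (g' \oc g) x = tmap f' g' (tmap f g x);
  tstr : forall H F G, {linear tval F G -> tval (H \ot F) (H \ot G)};
  tstr_nat : forall H F F' G G' (f : hom F' F) (g : hom G G') (x : tval F G),
    tstr H F' G' (tmap f g x) =
    tmap (idm H \otm f) (idm H \otm g) (tstr H F G x);
  tstr_extranat : forall H H' F G (h : hom H H') (x : tval F G),
    tmap (idm (H \ot F)) (h \otm idm G) (tstr H F G x) =
    tmap (h \otm idm F) (idm (H' \ot G)) (tstr H' F G x);
  tstr_assoc : forall K H F G (x : tval F G),
    tstr (K \ot H) F G x =
    tmap (fwd (assoc K H F)) (bwd (assoc K H G))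
      (tstr K (H \ot F) (H \ot G) (tstr H F G x));
  tstr_unit : forall F G (x : tval F G),
    tstr one F G x = tmap (fwd (lunit F)) (bwd (lunit G)) x
}.

End Tambara.

Arguments tmap {k C} t {F F' G G'} f g.
Arguments tstr {k C} t H {F G}.

Section TambaraMorphisms.

Variables (k : fieldType) (C : moncat k).

Record tmor (P Q : tambara C) : Type := TMor {
  tm :> forall F G, {linear P F G -> Q F G};
  tm_nat : forall F F' G G' (f : hom F' F) (g : hom G G') (x : P F G),
    tm F' G' (tmap P f g x) = tmap Q f g (tm F G x);
  tm_str : forall H F G (x : P F G),
    tm (H \ot F) (H \ot G) (tstr P H x) = tstr Q H (tm F G x)
}.

End TambaraMorphisms.

Arguments tm {k C P Q} t {F G}.

Section Unit.

Variables (k : fieldType) (C : moncat k).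

Lemma tunit_map_linear (F F' G G' : C) (f : hom F' F) (g : hom G G') :
  linear (fun x : hom F G => g \oc x \oc f).
Proof. by move=> c x y; rewrite comp_linr comp_linl. Qed.

Lemma tunit_str_linear (H F G : C) :
  linear (fun x : hom F G => idm H \otm x).
Proof. exact: tenm_linr. Qed.

Program Definition tunit : tambara C := @Tambara k C
  (fun F G => hom F G)
  (fun F F' G G' f g => mklinear (tunit_map_linear f g)) _ _ _ _
  (fun H F G => mklinear (@tunit_str_linear H F G)) _ _ _ _.
Next Obligation. by move=> F F' G G' g x c f f'; rewrite /= comp_linr. Qed.
Next Obligation. by move=> F F' G G' f x c g g'; rewrite /= !comp_linl. Qed.
Next Obligation. by move=> F G x; rewrite /= comp1m compm1. Qed.
Next Obligation. by move=> *; rewrite /= !compA. Qed.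
Next Obligation.
by move=> H F F' G G' f g x; rewrite /= -!tenm_comp !comp1m.
Qed.
Next Obligation.
move=> H H' F G h x; rewrite /= comp1m compm1 -!tenm_comp.
by rewrite !comp1m !compm1.
Qed.
Next Obligation.
move=> K H F G x; rewrite /= -compA -assoc_nat compA bwdK comp1m.
by rewrite tenm_id.
Qed.
Next Obligation.
by move=> F G x; rewrite /= -compA -lunit_nat compA bwdK comp1m.
Qed.

End Unit.

Section Diamond.

Variables (k : fieldType) (C : moncat k) (P Q : tambara C).

Definition dia_gens (F G : C) : Type := {H : C & (P F H * Q H G)%type}.

Definition dpair (F G H : C) (x : P F H) (y : Q H G) : lterm k (dia_gens F G) :=
  LGen k (existT _ H (x, y)).

(* dia_val F G is the coend over H of the tensor products of P F H and Q H G: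
   it is spanned by pure tensors, subject to bilinearity and dinaturality in H. *)
Inductive dia_rel (F G : C) :
  lterm k (dia_gens F G) -> lterm k (dia_gens F G) -> Prop :=
| dia_addl H (x x' : P F H) (y : Q H G) :
    dia_rel (dpair (x + x') y) (LAdd (dpair x y) (dpair x' y))
| dia_scalel H c (x : P F H) (y : Q H G) :
    dia_rel (dpair (c *: x) y) (LScale c (dpair x y))
| dia_addr H (x : P F H) (y y' : Q H G) :
    dia_rel (dpair x (y + y')) (LAdd (dpair x y) (dpair x y'))
| dia_scaler H c (x : P F H) (y : Q H G) :
    dia_rel (dpair x (c *: y)) (LScale c (dpair x y))
| dia_dinat H H' (h : hom H H') (x : P F H) (y : Q H' G) :
    dia_rel (dpair (tmap P (idm F) h x) y) (dpair x (tmap Q h (idm G) y)).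

Definition dia_val (F G : C) : lmodType k := pres (@dia_rel F G).

Definition dgen (F G H : C) (x : P F H) (y : Q H G) : dia_val F G :=
  gen (@dia_rel F G) (existT _ H (x, y)).

Lemma dgen_linl (F G H : C) (y : Q H G) : linear (fun x : P F H => dgen x y).
Proof.
move=> c x x'; rewrite /dgen.
have := gen_sat (dia_addl (c *: x) x' y); rewrite /= => ->; congr (_ + _).
by have := gen_sat (dia_scalel c x y).
Qed.

Lemma dgen_linr (F G H : C) (x : P F H) : linear (fun y : Q H G => dgen x y).
Proof.
move=> c y y'; rewrite /dgen.
have := gen_sat (dia_addr x (c *: y) y'); rewrite /= => ->; congr (_ + _).
by have := gen_sat (dia_scaler c x y).
Qed.

Lemma dgen_dinat (F G H H' : C) (h : hom H H') (x : P F H) (y : Q H' G) :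
  dgen (tmap P (idm F) h x) y = dgen x (tmap Q h (idm G) y).
Proof. exact: (gen_sat (dia_dinat h x y)). Qed.

Lemma dia_ext (F G : C) (V : lmodType k) (f g : dia_val F G -> V) :
  linear f -> linear g ->
  (forall H (x : P F H) (y : Q H G), f (dgen x y) = g (dgen x y)) ->
  forall z, f z = g z.
Proof.
move=> fL gL fg.
by apply: (pres_ext (f := mklinear fL) (g := mklinear gL)) => -[H [x y]]; exact: fg.
Qed.

Section Lift.

Variables (F G : C) (V : lmodType k) (b : forall H, P F H -> Q H G -> V).

Definition balanced : Prop :=
  [/\ forall H (y : Q H G), linear (fun x : P F H => b x y),
      forall H (x : P F H), linear (fun y : Q H G => b x y)
    & forall H H' (h : hom H H') (x : P F H) (y : Q H' G),
        b (tmap P (idm F) h x) y = b x (tmap Q h (idm G) y)].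

Lemma dia_lift_subproof :
  balanced -> lsat (@dia_rel F G) (fun t => b (projT2 t).1 (projT2 t).2).
Proof.
case=> linl linr dinat s t [] /=.
- by move=> H x x' y; rewrite -[x]scale1r linl !scale1r.
- move=> H c x y; have b0 : b 0 y = 0.
    by have := linl H y (-1) 0 0; rewrite scaler0 addr0 scaleN1r addNr.
  by have := linl H y c x 0; rewrite b0 !addr0.
- by move=> H x y y'; rewrite -[y]scale1r linr !scale1r.
- move=> H c x y; have b0 : b x 0 = 0.
    by have := linr H x (-1) 0 0; rewrite scaler0 addr0 scaleN1r addNr.
  by have := linr H x c y 0; rewrite b0 !addr0.
- by move=> H H' h x y; exact: dinat.
Qed.

Definition dia_lift (bP : balanced) : {linear dia_val F G -> V} :=
  pres_lift (dia_lift_subproof bP).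

Lemma dia_liftE (bP : balanced) H (x : P F H) (y : Q H G) :
  dia_lift bP (dgen x y) = b x y.
Proof. exact: pres_liftE. Qed.

End Lift.

Lemma dia_map_balanced (F F' G G' : C) (f : hom F' F) (g : hom G G') :
  @balanced F G (dia_val F' G')
    (fun H x y => dgen (tmap P f (idm H) x) (tmap Q (idm H) g y)).
Proof.
split=> [H y c x x'|H x c y y'|H H' h x y].
- by rewrite linearP dgen_linl.
- by rewrite linearP dgen_linr.
- rewrite -tmap_comp -tmap_comp !compm1 !comp1m.
  have -> : tmap P f h x = tmap P (idm F') h (tmap P f (idm H) x).
    by rewrite -tmap_comp compm1 compm1.
  rewrite dgen_dinat -tmap_comp.
  by rewrite !comp1m.
Qed.

Lemma dia_str_balanced (L F G : C) :
  @balanced F G (dia_val (L \ot F) (L \ot G))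
    (fun H x y => dgen (tstr P L x) (tstr Q L y)).
Proof.
split=> [H y c x x'|H x c y y'|H H' h x y].
- by rewrite linearP dgen_linl.
- by rewrite linearP dgen_linr.
- by rewrite !tstr_nat !tenm_id dgen_dinat.
Qed.

Definition dia_map F F' G G' f g := dia_lift (@dia_map_balanced F F' G G' f g).
Definition dia_str L F G := dia_lift (@dia_str_balanced L F G).

Lemma dia_mapE F F' G G' (f : hom F' F) (g : hom G G') H
    (x : P F H) (y : Q H G) :
  dia_map f g (dgen x y) = dgen (tmap P f (idm H) x) (tmap Q (idm H) g y).
Proof. exact: dia_liftE. Qed.

Lemma dia_strE L F G H (x : P F H) (y : Q H G) :
  dia_str L F G (dgen x y) = dgen (tstr P L x) (tstr Q L y).
Proof. exact: dia_liftE. Qed.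

Program Definition dia : tambara C :=
  @Tambara k C dia_val dia_map _ _ _ _ dia_str _ _ _ _.
Next Obligation.
move=> F F' G G' g z c f f'; pattern z; move: z.
apply: dia_ext => [a u v|a u v|H x y].
- by rewrite linearP.
- rewrite !(linearP (dia_map _ _)) !scalerDr !scalerA [c * a]mulrC.
  by rewrite addrACA.
- by rewrite !dia_mapE tmap_linl dgen_linl.
Qed.
Next Obligation.
move=> F F' G G' f z c g g'; pattern z; move: z.
apply: dia_ext => [a u v|a u v|H x y].
- by rewrite linearP.
- rewrite !(linearP (dia_map _ _)) !scalerDr !scalerA [c * a]mulrC.
  by rewrite addrACA.
- by rewrite !dia_mapE tmap_linr dgen_linr.
Qed.
Next Obligation.
move=> F G; apply: dia_ext => [a u v|//|H x y]; first by rewrite linearP.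
by rewrite dia_mapE !tmap_id.
Qed.
Next Obligation.
move=> F F' F'' G G' G'' f f' g' g.
apply: dia_ext => [a u v|a u v|H x y]; rewrite ?linearP //.
by rewrite !dia_mapE -!tmap_comp !comp1m.
Qed.
Next Obligation.
move=> L F F' G G' f g.
apply: dia_ext => [a u v|a u v|H x y]; rewrite ?linearP //.
by rewrite dia_mapE !dia_strE dia_mapE !tstr_nat !tenm_id.
Qed.
Next Obligation.
move=> H H' F G h.
apply: dia_ext => [a u v|a u v|K x y]; rewrite ?linearP //.
rewrite !dia_strE !dia_mapE !tmap_id.
by rewrite tstr_extranat -dgen_dinat tstr_extranat.
Qed.
Next Obligation.
move=> K H F G.
apply: dia_ext => [a u v|a u v|L x y]; rewrite ?linearP //.
rewrite !dia_strE !dia_mapE !tstr_assoc.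
set x' := tstr P K _; set y' := tstr Q K _.
have -> : tmap P (fwd (assoc K H F)) (bwd (assoc K H L)) x' =
    tmap P (idm _) (bwd (assoc K H L)) (tmap P (fwd (assoc K H F)) (idm _) x').
  by rewrite -tmap_comp !compm1.
rewrite dgen_dinat -tmap_comp; congr (dgen _ (tmap _ _ _ _)).
  by rewrite fwdK.
by rewrite comp1m.
Qed.
Next Obligation.
move=> F G.
apply: dia_ext => [a u v|a u v|L x y]; rewrite ?linearP //.
rewrite !dia_strE !dia_mapE !tstr_unit.
have -> : tmap P (fwd (lunit F)) (bwd (lunit L)) x =
    tmap P (idm _) (bwd (lunit L)) (tmap P (fwd (lunit F)) (idm _) x).
  by rewrite -tmap_comp !compm1.
rewrite dgen_dinat -tmap_comp; congr (dgen _ (tmap _ _ _ _)).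
  by rewrite fwdK.
by rewrite comp1m.
Qed.

Lemma tmap_diaE F F' G G' (f : hom F' F) (g : hom G G') H
    (x : P F H) (y : Q H G) :
  tmap dia f g (dgen x y) = dgen (tmap P f (idm H) x) (tmap Q (idm H) g y).
Proof. exact: dia_mapE. Qed.

Lemma tstr_diaE L F G H (x : P F H) (y : Q H G) :
  tstr dia L (dgen x y) = dgen (tstr P L x) (tstr Q L y).
Proof. exact: dia_strE. Qed.

End Diamond.

Arguments dia : simpl never.
Arguments dia_lift : simpl never.

Arguments dgen {k C P Q F G H} x y.

Notation "x \dt y" := (dgen x y) (at level 40, left associativity).

Section DiamondMor.

Variables (k : fieldType) (C : moncat k) (P Q S : tambara C).
Variable b : forall F G H, P F H -> Q H G -> S F G.

Definition tbalanced : Prop :=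
  [/\ forall F G, balanced (@b F G),
      forall F F' G G' H (f : hom F' F) (g : hom G G') (x : P F H) (y : Q H G),
        b (tmap P f (idm H) x) (tmap Q (idm H) g y) = tmap S f g (b x y)
    & forall L F G H (x : P F H) (y : Q H G),
        b (tstr P L x) (tstr Q L y) = tstr S L (b x y)].

Hypothesis bP : tbalanced.

Lemma tbal F G : balanced (@b F G). Proof. by case: bP. Qed.

Program Definition dia_tmor : tmor (dia P Q) S :=
  @TMor k C (dia P Q) S (fun F G => dia_lift (@tbal F G)) _ _.
Next Obligation.
move=> F F' G G' f g; apply: dia_ext => [a u v|a u v|H x y]; rewrite ?linearP //.
by rewrite dia_mapE !dia_liftE; case: bP => _ ->.
Qed.
Next Obligation.
move=> L F G; apply: dia_ext => [a u v|a u v|H x y]; rewrite ?linearP //.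
by rewrite dia_strE !dia_liftE; case: bP => _ _ ->.
Qed.

Lemma dia_tmorE F G H (x : P F H) (y : Q H G) : dia_tmor F G (x \dt y) = b x y.
Proof. exact: dia_liftE. Qed.

End DiamondMor.

Arguments dia_tmor : simpl never.

Section Monoids.

Variables (k : fieldType) (C : moncat k).

(* The associator of the monoidal category of Tambara modules is
   (a (x) b) (x) c |-> a (x) (b (x) c), and its unitors are
   f (x) x |-> P(f, G)(x) and x (x) g |-> P(F, g)(x).  As the pure tensors
   generate the coends, the laws of monoids and bimodules are stated on them. *)
Record tmonoid : Type := TMonoid {
  mon_obj :> tambara C;
  mmul : tmor (dia mon_obj mon_obj) mon_obj;
  munit : tmor (tunit C) mon_obj;
  mmulA : forall F H K G
      (a : mon_obj F H) (b : mon_obj H K) (c : mon_obj K G),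
    tm mmul (tm mmul (a \dt b) \dt c) = tm mmul (a \dt tm mmul (b \dt c));
  mmul1l : forall F H G (f : hom F H) (x : mon_obj H G),
    tm mmul (tm munit f \dt x) = tmap mon_obj f (idm G) x;
  mmul1r : forall F H G (x : mon_obj F H) (g : hom H G),
    tm mmul (x \dt tm munit g) = tmap mon_obj (idm F) g x
}.

Record bimod (A B : tmonoid) : Type := Bimod {
  bm_obj :> tambara C;
  lact : tmor (dia A bm_obj) bm_obj;
  ract : tmor (dia bm_obj B) bm_obj;
  lactA : forall F H K G (a : A F H) (a' : A H K) (x : bm_obj K G),
    tm lact (tm (mmul A) (a \dt a') \dt x) = tm lact (a \dt tm lact (a' \dt x));
  lact1 : forall F H G (f : hom F H) (x : bm_obj H G),
    tm lact (tm (munit A) f \dt x) = tmap bm_obj f (idm G) x;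
  ractA : forall F H K G (x : bm_obj F H) (b : B H K) (b' : B K G),
    tm ract (x \dt tm (mmul B) (b \dt b')) = tm ract (tm ract (x \dt b) \dt b');
  ract1 : forall F H G (x : bm_obj F H) (g : hom H G),
    tm ract (x \dt tm (munit B) g) = tmap bm_obj (idm F) g x;
  lractA : forall F H K G (a : A F H) (x : bm_obj H K) (b : B K G),
    tm ract (tm lact (a \dt x) \dt b) = tm lact (a \dt tm ract (x \dt b))
}.

Definition regular_bimod (A : tmonoid) : bimod A A :=
  @Bimod A A A (mmul A) (mmul A) (@mmulA A) (@mmul1l A)
    (fun F H K G x b b' => esym (@mmulA A F H K G x b b')) (@mmul1r A)
    (@mmulA A).

Definition bimod_isomorphic (A B : tmonoid) (M N : bimod A B) : Prop :=
  exists (u : tmor M N) (v : tmor N M),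
    [/\ forall F G (x : M F G), tm v (tm u x) = x,
        forall F G (y : N F G), tm u (tm v y) = y,
        forall F H G (a : A F H) (x : M H G),
          tm u (tm (lact M) (a \dt x)) = tm (lact N) (a \dt tm u x)
      & forall F H G (x : M F H) (b : B H G),
          tm u (tm (ract M) (x \dt b)) = tm (ract N) (tm u x \dt b)].

End Monoids.

Arguments lact {k C A B} _.
Arguments ract {k C A B} _.
Arguments mmul {k C} t.
Arguments munit {k C} t.

Section RelativeTensor.

Variables (k : fieldType) (C : moncat k) (A B D : tmonoid C).
Variables (M : bimod A B) (N : bimod B D).

Definition rt_gen (F G : C) (z : dia M N F G) : lterm k (dia M N F G) :=
  LGen k z.

(* The coequaliser of the two actions (M <> B) <> N => M <> N, where <> is dia,
   computed pointwise as a quotient of (M <> N)(F, G). *)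
Inductive rt_rel (F G : C) :
  lterm k (dia M N F G) -> lterm k (dia M N F G) -> Prop :=
| rt_add (z z' : dia M N F G) :
    rt_rel (rt_gen (z + z')) (LAdd (rt_gen z) (rt_gen z'))
| rt_scale c (z : dia M N F G) :
    rt_rel (rt_gen (c *: z)) (LScale c (rt_gen z))
| rt_act H K (x : M F H) (b : B H K) (y : N K G) :
    rt_rel (rt_gen (tm (ract M) (x \dt b) \dt y))
           (rt_gen (x \dt tm (lact N) (b \dt y))).

Definition rt_val (F G : C) : lmodType k := pres (@rt_rel F G).

Lemma rt_class_linear F G :
  linear (fun z : dia M N F G => gen (@rt_rel F G) z : rt_val F G).
Proof.
move=> c z z'; have /= -> := gen_sat (rt_add (c *: z) z'); congr (_ + _).
by have /= -> := gen_sat (rt_scale c z).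
Qed.

Definition rt_class F G : {linear dia M N F G -> rt_val F G} :=
  mklinear (@rt_class_linear F G).

Lemma rt_classE F G H K (x : M F H) (b : B H K) (y : N K G) :
  rt_class F G (tm (ract M) (x \dt b) \dt y) =
  rt_class F G (x \dt tm (lact N) (b \dt y)).
Proof. exact: (gen_sat (rt_act x b y)). Qed.

Lemma rt_ext (F G : C) (V : lmodType k) (f g : rt_val F G -> V) :
  linear f -> linear g ->
  (forall H (x : M F H) (y : N H G),
     f (rt_class F G (x \dt y)) = g (rt_class F G (x \dt y))) ->
  forall w, f w = g w.
Proof.
move=> fL gL fg.
apply: (pres_ext (f := mklinear fL) (g := mklinear gL)) => z.
have fE t : mklinear fL (gen (@rt_rel F G) t) = f (rt_class F G t) by [].
have gE t : mklinear gL (gen (@rt_rel F G) t) = g (rt_class F G t) by [].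
rewrite fE gE; pattern z; move: z.
by apply: dia_ext => [c u v|c u v|H x y]; rewrite ?linearP ?fL ?gL ?fg.
Qed.

Section Lift.

Variables (F G : C) (V : lmodType k) (f : {linear dia M N F G -> V}).

Definition rt_compat : Prop :=
  forall H K (x : M F H) (b : B H K) (y : N K G),
    f (tm (ract M) (x \dt b) \dt y) = f (x \dt tm (lact N) (b \dt y)).

Lemma rt_lift_subproof : rt_compat -> lsat (@rt_rel F G) f.
Proof.
move=> fP s t [z z'|c z|H K x b y] /=; last exact: fP.
- exact: linearD.
- exact: linearZ.
Qed.

Definition rt_lift (fP : rt_compat) : {linear rt_val F G -> V} :=
  pres_lift (rt_lift_subproof fP).

Lemma rt_liftE (fP : rt_compat) z : rt_lift fP (rt_class F G z) = f z.
Proof. exact: pres_liftE. Qed.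

End Lift.

Lemma rt_map_linear (F F' G G' : C) (f : hom F' F) (g : hom G G') :
  linear (fun z => rt_class F' G' (tmap (dia M N) f g z)).
Proof. by move=> c z z'; rewrite !linearP. Qed.

Lemma rt_map_compat (F F' G G' : C) (f : hom F' F) (g : hom G G') :
  rt_compat (mklinear (rt_map_linear f g)).
Proof.
move=> H K x b y; rewrite !(mklinearE (rt_map_linear f g)) !tmap_diaE.
have -> : tmap M f (idm K) (tm (ract M) (x \dt b)) =
    tm (ract M) (tmap M f (idm H) x \dt b).
  by rewrite -tm_nat tmap_diaE tmap_id.
by rewrite rt_classE -tm_nat tmap_diaE tmap_id.
Qed.

Lemma rt_str_linear (L F G : C) :
  linear (fun z => rt_class (L \ot F) (L \ot G) (tstr (dia M N) L z)).
Proof. by move=> c z z'; rewrite !linearP. Qed.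

Lemma rt_str_compat (L F G : C) : rt_compat (mklinear (@rt_str_linear L F G)).
Proof.
move=> H K x b y; rewrite !(mklinearE (@rt_str_linear L F G)) !tstr_diaE.
rewrite -!tm_str !tstr_diaE.
exact: rt_classE.
Qed.

Definition rt_map F F' G G' f g := rt_lift (@rt_map_compat F F' G G' f g).
Definition rt_str L F G := rt_lift (@rt_str_compat L F G).

Lemma rt_mapE F F' G G' (f : hom F' F) (g : hom G G') z :
  rt_map f g (rt_class F G z) = rt_class F' G' (tmap (dia M N) f g z).
Proof. exact: rt_liftE. Qed.

Lemma rt_strE L F G z :
  rt_str L F G (rt_class F G z) =
  rt_class (L \ot F) (L \ot G) (tstr (dia M N) L z).
Proof. exact: rt_liftE. Qed.

Program Definition rt_tambara : tambara C :=
  @Tambara k C rt_val rt_map _ _ _ _ rt_str _ _ _ _.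
Next Obligation.
move=> F F' G G' g w c f f'; pattern w; move: w.
apply: rt_ext => [a u v|a u v|H x y].
- by rewrite linearP.
- rewrite !(linearP (rt_map _ _)) !scalerDr !scalerA [c * a]mulrC.
  by rewrite addrACA.
- by rewrite !rt_mapE tmap_linl linearP.
Qed.
Next Obligation.
move=> F F' G G' f w c g g'; pattern w; move: w.
apply: rt_ext => [a u v|a u v|H x y].
- by rewrite linearP.
- rewrite !(linearP (rt_map _ _)) !scalerDr !scalerA [c * a]mulrC.
  by rewrite addrACA.
- by rewrite !rt_mapE tmap_linr linearP.
Qed.
Next Obligation.
move=> F G; apply: rt_ext => [a u v|//|H x y]; first by rewrite linearP.
by rewrite rt_mapE tmap_id.
Qed.
Next Obligation.
move=> F F' F'' G G' G'' f f' g' g.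
apply: rt_ext => [a u v|a u v|H x y]; rewrite ?linearP //.
by rewrite !rt_mapE tmap_comp.
Qed.
Next Obligation.
move=> L F F' G G' f g.
apply: rt_ext => [a u v|a u v|H x y]; rewrite ?linearP //.
by rewrite rt_mapE !rt_strE rt_mapE tstr_nat.
Qed.
Next Obligation.
move=> H H' F G h.
apply: rt_ext => [a u v|a u v|K x y]; rewrite ?linearP //.
by rewrite !rt_strE !rt_mapE tstr_extranat.
Qed.
Next Obligation.
move=> K H F G.
apply: rt_ext => [a u v|a u v|L x y]; rewrite ?linearP //.
by rewrite !rt_strE rt_mapE tstr_assoc.
Qed.
Next Obligation.
move=> F G.
apply: rt_ext => [a u v|a u v|L x y]; rewrite ?linearP //.
by rewrite !rt_strE rt_mapE tstr_unit.
Qed.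

Lemma tmap_rtE F F' G G' (f : hom F' F) (g : hom G G') (z : dia M N F G) :
  tmap rt_tambara f g (rt_class F G z) = rt_class F' G' (tmap (dia M N) f g z).
Proof. exact: rt_mapE. Qed.

Lemma tstr_rtE L F G (z : dia M N F G) :
  tstr rt_tambara L (rt_class F G z) =
  rt_class (L \ot F) (L \ot G) (tstr (dia M N) L z).
Proof. exact: rt_strE. Qed.

Arguments rt_tambara : simpl never.
Arguments rt_lift : simpl never.

Section LeftAction.

Variables (F H : C) (a : A F H).

Lemma rt_lact1_balanced G :
  @balanced k C M N H G (rt_val F G)
    (fun K x y => rt_class F G (tm (lact M) (a \dt x) \dt y)).
Proof.
split=> [K y c x x'|K x c y y'|K K' h x y].
- by rewrite dgen_linr linearP dgen_linl linearP.
- by rewrite dgen_linr linearP.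
- congr (rt_class F G _); rewrite -dgen_dinat; congr (_ \dt _).
  by rewrite -tm_nat tmap_diaE tmap_id.
Qed.

Definition rt_lact2 G := dia_lift (@rt_lact1_balanced G).

Lemma rt_lact2_compat G : rt_compat (rt_lact2 G).
Proof.
move=> K K' x b y; rewrite !dia_liftE -lractA.
exact: rt_classE.
Qed.

Definition rt_lact3 G : {linear rt_val H G -> rt_val F G} :=
  rt_lift (@rt_lact2_compat G).

Lemma rt_lact3E G K (x : M H K) (y : N K G) :
  rt_lact3 G (rt_class H G (x \dt y)) =
  rt_class F G (tm (lact M) (a \dt x) \dt y).
Proof. by rewrite rt_liftE dia_liftE. Qed.

End LeftAction.

Section RightAction.

Variables (H G : C) (d : D H G).

Lemma rt_ract1_balanced F :
  @balanced k C M N F H (rt_val F G)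
    (fun K x y => rt_class F G (x \dt tm (ract N) (y \dt d))).
Proof.
split=> [K y c x x'|K x c y y'|K K' h x y].
- by rewrite dgen_linl linearP.
- by rewrite dgen_linl linearP dgen_linr linearP.
- congr (rt_class F G _); rewrite dgen_dinat; congr (_ \dt _).
  by rewrite -tm_nat tmap_diaE tmap_id.
Qed.

Definition rt_ract2 F := dia_lift (@rt_ract1_balanced F).

Lemma rt_ract2_compat F : rt_compat (rt_ract2 F).
Proof.
move=> K K' x b y; rewrite !dia_liftE lractA.
exact: rt_classE.
Qed.

Definition rt_ract3 F : {linear rt_val F H -> rt_val F G} :=
  rt_lift (@rt_ract2_compat F).

Lemma rt_ract3E F K (x : M F K) (y : N K H) :
  rt_ract3 F (rt_class F H (x \dt y)) =
  rt_class F G (x \dt tm (ract N) (y \dt d)).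
Proof. by rewrite rt_liftE dia_liftE. Qed.

End RightAction.

Lemma rt_lact_balanced :
  @tbalanced k C A rt_tambara rt_tambara
    (fun F G H a w => rt_lact3 a G w).
Proof.
split.
- move=> F G; split=> [H w c a a'|H a|H H' h a].
  + pattern w; move: w; apply: rt_ext => [e u v|e u v|K x y].
    * by rewrite linearP.
    * rewrite !(linearP (rt_lact3 _ _)) !scalerDr !scalerA [c * e]mulrC.
      by rewrite addrACA.
    * by rewrite !rt_lact3E dgen_linl linearP dgen_linl linearP.
  + exact: linearP.
  + apply: rt_ext => [e u v|e u v|K x y]; rewrite ?linearP //.
    rewrite rt_lact3E dgen_dinat tmap_rtE tmap_diaE.
    by rewrite rt_lact3E tmap_id.
- move=> F F' G G' H f g a.
  apply: rt_ext => [e u v|e u v|K x y]; rewrite ?linearP //.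
  rewrite !tmap_rtE !tmap_diaE !rt_lact3E tmap_rtE tmap_diaE.
  by rewrite -tm_nat tmap_diaE !tmap_id.
- move=> L F G H a.
  apply: rt_ext => [e u v|e u v|K x y]; rewrite ?linearP //.
  rewrite !tstr_rtE !tstr_diaE !rt_lact3E tstr_rtE tstr_diaE.
  by rewrite -tm_str tstr_diaE.
Qed.

Lemma rt_ract_balanced :
  @tbalanced k C rt_tambara D rt_tambara
    (fun F G H w d => rt_ract3 d F w).
Proof.
split.
- move=> F G; split=> [H d|H w c d d'|H H' h w d].
  + exact: linearP.
  + pattern w; move: w; apply: rt_ext => [e u v|e u v|K x y].
    * by rewrite linearP.
    * rewrite !(linearP (rt_ract3 _ _)) !scalerDr !scalerA [c * e]mulrC.
      by rewrite addrACA.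
    * by rewrite !rt_ract3E dgen_linr linearP dgen_linr linearP.
  + pattern w; move: w.
    apply: rt_ext => [e u v|e u v|K x y]; rewrite ?linearP //.
    rewrite rt_ract3E -dgen_dinat tmap_rtE tmap_diaE.
    by rewrite rt_ract3E tmap_id.
- move=> F F' G G' H f g w d; pattern w; move: w.
  apply: rt_ext => [e u v|e u v|K x y]; rewrite ?linearP //.
  rewrite !tmap_rtE !tmap_diaE !rt_ract3E tmap_rtE tmap_diaE.
  by rewrite -tm_nat tmap_diaE !tmap_id.
- move=> L F G H w d; pattern w; move: w.
  apply: rt_ext => [e u v|e u v|K x y]; rewrite ?linearP //.
  rewrite !tstr_rtE !tstr_diaE !rt_ract3E tstr_rtE tstr_diaE.
  by rewrite -tm_str tstr_diaE.
Qed.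

Definition rt_lact : tmor (dia A rt_tambara) rt_tambara :=
  dia_tmor rt_lact_balanced.
Definition rt_ract : tmor (dia rt_tambara D) rt_tambara :=
  dia_tmor rt_ract_balanced.

Lemma rt_lactE F H G K (a : A F H) (x : M H K) (y : N K G) :
  tm rt_lact (a \dt (rt_class H G (x \dt y) : rt_tambara H G)) =
  rt_class F G (tm (lact M) (a \dt x) \dt y).
Proof. by rewrite dia_tmorE rt_lact3E. Qed.

Lemma rt_ractE F H G K (x : M F K) (y : N K H) (d : D H G) :
  tm rt_ract ((rt_class F H (x \dt y) : rt_tambara F H) \dt d) =
  rt_class F G (x \dt tm (ract N) (y \dt d)).
Proof. by rewrite dia_tmorE rt_ract3E. Qed.

Program Definition rel_tensor : bimod A D :=
  @Bimod k C A D rt_tambara rt_lact rt_ract _ _ _ _ _.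
Next Obligation.
move=> F H K G a a'.
apply: rt_ext => [e u v|e u v|L x y]; rewrite ?dgen_linr ?linearP //.
  by rewrite dgen_linr linearP.
by rewrite !rt_lactE lactA.
Qed.
Next Obligation.
move=> F H G f.
apply: rt_ext => [e u v|e u v|L x y]; rewrite ?dgen_linr ?linearP //.
by rewrite !rt_lactE lact1 tmap_rtE tmap_diaE tmap_id.
Qed.
Next Obligation.
move=> F H K G w b b'; pattern w; move: w.
apply: rt_ext => [e u v|e u v|L x y]; rewrite ?dgen_linl ?linearP //.
  by rewrite dgen_linl linearP.
by rewrite !rt_ractE ractA.
Qed.
Next Obligation.
move=> F H G w g; pattern w; move: w.
apply: rt_ext => [e u v|e u v|L x y]; rewrite ?dgen_linl ?linearP //.
by rewrite !rt_ractE ract1 tmap_rtE tmap_diaE tmap_id.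
Qed.
Next Obligation.
move=> F H K G a w d; pattern w; move: w.
apply: rt_ext => [e u v|e u v|L x y].
- by rewrite dgen_linr linearP dgen_linl linearP.
- by rewrite dgen_linl linearP dgen_linr linearP.
by rewrite rt_lactE !rt_ractE rt_lactE.
Qed.

End RelativeTensor.

Section Morita.

Variables (k : fieldType) (C : moncat k).

Definition morita_equivalent (A B : tmonoid C) : Prop :=
  exists (M : bimod A B) (N : bimod B A),
    bimod_isomorphic (rel_tensor M N) (regular_bimod A) /\
    bimod_isomorphic (rel_tensor N M) (regular_bimod B).

End Morita.

Section InternalEnd.

Variables (k : fieldType) (C : moncat k) (M : modcat C) (X : M).

Lemma iend_map_linear (F F' G G' : C) (f : hom F' F) (g : hom G G') :
  linear (fun x : hom (act F X) (act G X) => actm X g \oc x \oc actm X f).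
Proof. by move=> c x y; rewrite comp_linr comp_linl. Qed.

Lemma iend_str_linear (H F G : C) :
  linear (fun x : hom (act F X) (act G X) =>
    fwd (mten H G X) \oc fmap (act H) x \oc bwd (mten H F X)).
Proof. by move=> c x y; rewrite linearP comp_linr comp_linl. Qed.

Lemma mten_natm_bwd (G G' F F' : C) (g : hom G G') (f : hom F F') :
  actm (act F' X) g \oc fmap (act G) (actm X f) \oc bwd (mten G F X) =
  bwd (mten G' F' X) \oc actm X (g \otm f).
Proof.
rewrite -[LHS]comp1m -(bwdK (mten G' F' X)) -[LHS]compA; congr (_ \oc _).
by rewrite compA mten_natm -compA fwdK compm1.
Qed.

Lemma mten_natr (H G G' : C) (g : hom G G') :
  fwd (mten H G' X) \oc fmap (act H) (actm X g) =
  actm X (idm H \otm g) \oc fwd (mten H G X).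
Proof. by rewrite -mten_natm actm_id comp1m. Qed.

Lemma mten_natr_bwd (H F F' : C) (f : hom F F') :
  fmap (act H) (actm X f) \oc bwd (mten H F X) =
  bwd (mten H F' X) \oc actm X (idm H \otm f).
Proof. by rewrite -mten_natm_bwd actm_id comp1m. Qed.

Lemma mten_natl (H H' G : C) (h : hom H H') :
  actm X (h \otm idm G) \oc fwd (mten H G X) =
  fwd (mten H' G X) \oc actm (act G X) h.
Proof. by rewrite -mten_natm actm_id fmap_id compm1. Qed.

Lemma mten_natl_bwd (H H' F : C) (h : hom H H') :
  bwd (mten H' F X) \oc actm X (h \otm idm F) =
  actm (act F X) h \oc bwd (mten H F X).
Proof. by rewrite -mten_natm_bwd actm_id fmap_id compm1. Qed.

Lemma mten_assoc_bwd (K H F : C) :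
  fmap (act K) (bwd (mten H F X)) \oc bwd (mten K (H \ot F) X)
    \oc actm X (fwd (assoc K H F)) =
  bwd (mten K H (act F X)) \oc bwd (mten (K \ot H) F X).
Proof.
set m := fwd (mten K (H \ot F) X) \oc fmap (act K) (fwd (mten H F X)).
have mV : fmap (act K) (bwd (mten H F X)) \oc bwd (mten K (H \ot F) X) \oc m =
    idm _.
  rewrite /m compA -[_ \oc bwd (mten K _ X) \oc _]compA bwdK compm1.
  by rewrite -fmap_comp bwdK fmap_id.
rewrite -[RHS]comp1m -mV -[RHS]compA /m mten_assoc -!compA.
congr (_ \oc (_ \oc _)).
rewrite [X in actm _ _ \oc X](_ : _ = idm _) ?compm1 //.
by rewrite (compA (fwd (mten K H _))) fwdK comp1m fwdK.
Qed.

Lemma mone_act (F : C) :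
  bwd (mten one F X) = fwd (mone (act F X)) \oc actm X (fwd (lunit F)).
Proof.
have aV : actm X (bwd (lunit F)) \oc actm X (fwd (lunit F)) = idm _.
  by rewrite -actm_comp bwdK actm_id.
have mE : fwd (mten one F X) \oc fwd (mone (act F X)) = actm X (bwd (lunit F)).
  by rewrite -[LHS]comp1m -aV -compA [X in _ \oc X]compA mten_lunit compm1.
by rewrite -[LHS]compm1 -aV -mE !compA bwdK comp1m.
Qed.

(* The internal hom [X, X]. *)
Program Definition iend : tambara C := @Tambara k C
  (fun F G => hom (act F X) (act G X))
  (fun F F' G G' f g => mklinear (iend_map_linear f g)) _ _ _ _
  (fun H F G => mklinear (@iend_str_linear H F G)) _ _ _ _.
Next Obligation.
by move=> F F' G G' g x c f f'; rewrite /= linearP comp_linr.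
Qed.
Next Obligation.
by move=> F F' G G' f x c g g'; rewrite /= linearP !comp_linl.
Qed.
Next Obligation. by move=> F G x; rewrite /= !actm_id comp1m compm1. Qed.
Next Obligation. by move=> *; rewrite /= !actm_comp !compA. Qed.
Next Obligation.
move=> H F F' G G' f g x; rewrite /= !fmap_comp !compA mten_natr -!compA.
by rewrite mten_natr_bwd.
Qed.
Next Obligation.
move=> H H' F G h x; rewrite /= !actm_id comp1m compm1 !compA mten_natl.
rewrite -[RHS]compA mten_natl_bwd !compA; congr (_ \oc _).
by rewrite -[LHS]compA actm_nat compA.
Qed.
Next Obligation.
move=> K H F G x; rewrite /= !fmap_comp.
have e : actm X (bwd (assoc K H G)) \oc
    (fwd (mten K (H \ot G) X) \oc fmap (act K) (fwd (mten H G X))) =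
    fwd (mten (K \ot H) G X) \oc fwd (mten K H (act G X)).
  by rewrite mten_assoc !compA -actm_comp bwdK actm_id comp1m.
transitivity (fwd (mten (K \ot H) G X) \oc fwd (mten K H (act G X))
    \oc fmap (act K) (fmap (act H) x)
    \oc (bwd (mten K H (act F X)) \oc bwd (mten (K \ot H) F X))).
  rewrite -[_ \oc _ \oc fmap (act K) _]compA mten_nat !compA.
  by rewrite -[_ \oc fwd _ \oc bwd _]compA fwdK compm1.
by rewrite -e -mten_assoc_bwd !compA.
Qed.
Next Obligation.
move=> F G x; rewrite /= mone_act !compA; congr (_ \oc _).
rewrite -[_ \oc fmap _ _ \oc _]compA -mone_nat compA; congr (_ \oc _).
have aV : actm X (bwd (lunit G)) \oc actm X (fwd (lunit G)) = idm _.
  by rewrite -actm_comp bwdK actm_id.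
by rewrite -[LHS]comp1m -aV -[LHS]compA [X in _ \oc X]compA mten_lunit compm1.
Qed.

Program Definition iend_mul : tmor (dia iend iend) iend :=
  @dia_tmor k C iend iend iend (fun F G H b c => c \oc b) _.
Next Obligation.
split=> [F G|F F' G G' H f g x y|L F G H x y].
- split=> [H y c x x'|H x c y y'|H H' h x y] /=.
  + by rewrite comp_linr.
  + by rewrite comp_linl.
  + by rewrite !actm_id compm1 comp1m compA.
- by rewrite /= !actm_id compm1 comp1m !compA.
- rewrite /= fmap_comp !compA -!compA; congr (_ \oc (_ \oc _)).
  by rewrite !compA bwdK comp1m.
Qed.

Program Definition iend_unit : tmor (tunit C) iend :=
  @TMor k C (tunit C) iend (fun F G => actm X) _ _.
Next Obligation. by move=> *; rewrite /= !actm_comp. Qed.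
Next Obligation.
by move=> H F G x; rewrite /= mten_natr -compA fwdK compm1.
Qed.

Program Definition end_monoid : tmonoid C :=
  @TMonoid k C iend iend_mul iend_unit _ _ _.
Next Obligation. by move=> *; rewrite !dia_tmorE compA. Qed.
Next Obligation.
by move=> F H G f x; rewrite dia_tmorE /= actm_id comp1m.
Qed.
Next Obligation.
by move=> F H G x g; rewrite dia_tmorE /= actm_id compm1.
Qed.

End InternalEnd.

(* Main.v *)
From mathcomp Require Import all_boot all_algebra.
From mathcomp Require Import boolp.
Require Import Defs.

Set Implicit Arguments.
Unset Strict Implicit.
Unset Printing Implicit Defensive.

Import GRing.Theory.
Local Open Scope ring_scope.

#[local] Obligation Tactic := idtac.

(** A monoid A in Tambara modules is the same thing as a category with the
    objects of C, carrying an action of C and receiving an equivariant functor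
    from C that is the identity on objects.  For A = [X, X] this category is the
    full subcategory of M on the objects F X, and since X is a cyclic generator
    M is its completion under direct sums and retracts.  Bimodules are
    equivariant profunctors, and an invertible profunctor between two such
    categories is the same as an equivalence between their completions.  The
    proof makes this concrete, with Morita contexts as the middle term: two
    bimodules P and Q with surjective pairings mu : P (x) Q -> A and
    nu : Q (x) P -> B that are associative, mu(x, y) z = x nu(y, z) and
    nu(y, x) z = y mu(x, z).

    The isomorphisms given by a Morita equivalence do not satisfy these two
    identities: they only do so up to an automorphism of P.  Composing one of
    them with the inverse of this automorphism gives a context
    (morita_equivalent_context).  Conversely the pairings of a context are
    isomorphisms, because an expression of the identity of A as a sum of values
    of mu produces an inverse (context_morita_equivalent).

    An equivalence Phi : M -> N gives a context with P(F, G) = Hom(Phi(F X), G Y)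
    and Q(F, G) = Hom(F Y, Phi(G X)), in which both pairings are composition.
    They are surjective because each of the families Phi(F X) and F Y generates N
    (equivalence_context).

    Given a context, the four modules A, P, Q, B are the Hom spaces of one
    category on two copies of the objects of C.  The identity of an object Z of M
    is a sum of endomorphisms that pass through objects F X, and each identity of
    F X is a sum of composites through objects G Y of this category.  Hence Z
    should correspond to a retract of a finite direct sum of objects G Y, and it
    does: the idempotent has coefficients in B, so it lives in N and splits there
    (realization_exists).  The resulting object of N has the universal property
    of a colimit that every linear functor preserves (rz_descE).  Functoriality,
    the compatibility isomorphisms with the action of C and their coherence are
    all obtained by testing on the maps G Y -> E(Z) of this colimit.  The functor
    is fully faithful (rf_faithful, rf_full), and each object of N is a retract
    of an object in its image (rf_retract), so it is an equivalence. *)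

(** * Spans and descent for relative tensor products *)

Section LinearFunctions.

Variables (k : fieldType) (U V : lmodType k) (f : U -> V).
Hypothesis fL : linear f.

Lemma lin_sum I (r : seq I) (E : I -> U) :
  f (\sum_(i <- r) E i) = \sum_(i <- r) f (E i).
Proof. exact: (linear_sum (mklinear fL)). Qed.

Lemma linB x y : f (x - y) = f x - f y.
Proof. exact: (linearB (mklinear fL)). Qed.

Lemma linZ c x : f (c *: x) = c *: f x.
Proof. exact: (linearZ_LR (mklinear fL)). Qed.

Lemma lin0 : f 0 = 0.
Proof. exact: (linear0 (mklinear fL)). Qed.

End LinearFunctions.

Lemma pres_ind (k : fieldType) (T : Type) (R : lterm k T -> lterm k T -> Prop)
    (S : pres R -> Prop) :
  S 0 -> (forall x y, S x -> S y -> S (x + y)) ->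
  (forall c x, S x -> S (c *: x)) -> (forall t, S (gen R t)) ->
  forall x, S x.
Proof.
move=> S0 SD SZ Sg; elim/cls_ind => s; rewrite -leval_gen.
elim: s => [t||s IHs t IHt|c s IHs] //=; [exact: SD | exact: SZ].
Qed.

Section Span.

Variables (k : fieldType) (C : moncat k) (P Q : tambara C).

Definition tens (F G : C) : Type := {H : C & (P F H * Q H G)%type}.

Lemma dia_span F G (z : dia P Q F G) :
  exists r : seq (tens F G),
    z = \sum_(s <- r) ((projT2 s).1 \dt (projT2 s).2).
Proof.
elim/pres_ind: z => [|x y [r ->] [r' ->]|c x [r ->]|[H [x y]]].
- by exists [::]; rewrite big_nil.
- by exists (r ++ r'); rewrite big_cat.
- exists [seq existT _ (projT1 s) (c *: (projT2 s).1, (projT2 s).2) : tens F G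
    | s <- r].
  rewrite big_map scaler_sumr; apply: eq_bigr => s _ /=.
  by rewrite (linZ (dgen_linl _)).
- by exists [:: existT _ H (x, y) : tens F G]; rewrite big_seq1.
Qed.

End Span.

Section Actions.

Variables (k : fieldType) (C : moncat k).

Definition mon_mul (A : tmonoid C) F H G (a : A F H) (b : A H G) : A F G :=
  tm (mmul A) (a \dt b).

Definition mon_one (A : tmonoid C) F : A F F := tm (munit A) (idm F).

Variables (A B : tmonoid C) (P : bimod A B).

Definition lmul F H G (a : A F H) (x : P H G) : P F G := tm (lact P) (a \dt x).

Definition rmul F H G (x : P F H) (b : B H G) : P F G := tm (ract P) (x \dt b).

End Actions.

Notation "a \*m b" := (mon_mul a b) (at level 40, left associativity).
Notation "a \*l x" := (lmul a x) (at level 40, left associativity).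
Notation "x \*r b" := (rmul x b) (at level 40, left associativity).

Section ActionTheory.

Variables (k : fieldType) (C : moncat k).

Section Monoid.

Variable A : tmonoid C.

Lemma mon_mulA F H K G (a : A F H) (b : A H K) (c : A K G) :
  a \*m b \*m c = a \*m (b \*m c).
Proof. exact: mmulA. Qed.

Lemma mon_mul1m F G (a : A F G) : mon_one A F \*m a = a.
Proof. by rewrite /mon_mul mmul1l tmap_id. Qed.

Lemma mon_mulm1 F G (a : A F G) : a \*m mon_one A G = a.
Proof. by rewrite /mon_mul mmul1r tmap_id. Qed.

Lemma mon_mul_linl F H G (b : A H G) : linear (fun a : A F H => a \*m b).
Proof. by move=> c a a'; rewrite /mon_mul dgen_linl linearP. Qed.

Lemma mon_mul_linr F H G (a : A F H) : linear (fun b : A H G => a \*m b).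
Proof. by move=> c b b'; rewrite /mon_mul dgen_linr linearP. Qed.

Lemma mon_mul_str L F H G (a : A F H) (b : A H G) :
  tstr A L (a \*m b) = tstr A L a \*m tstr A L b.
Proof. by rewrite /mon_mul -tm_str tstr_diaE. Qed.

Lemma mon_one_str L F : tstr A L (mon_one A F) = mon_one A (L \ot F).
Proof. by rewrite /mon_one -tm_str /= tenm_id. Qed.

End Monoid.

Section Bimodule.

Variables (A B : tmonoid C) (P : bimod A B).

Lemma lmulA F H K G (a : A F H) (a' : A H K) (x : P K G) :
  (a \*m a') \*l x = a \*l (a' \*l x).
Proof. exact: lactA. Qed.

Lemma rmulA F H K G (x : P F H) (b : B H K) (b' : B K G) :
  x \*r (b \*m b') = x \*r b \*r b'.
Proof. exact: ractA. Qed.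

Lemma lrmulA F H K G (a : A F H) (x : P H K) (b : B K G) :
  a \*l x \*r b = a \*l (x \*r b).
Proof. exact: lractA. Qed.

Lemma lmul1 F G (x : P F G) : mon_one A F \*l x = x.
Proof. by rewrite /lmul lact1 tmap_id. Qed.

Lemma rmul1 F G (x : P F G) : x \*r mon_one B G = x.
Proof. by rewrite /rmul ract1 tmap_id. Qed.

Lemma lmul_linl F H G (x : P H G) : linear (fun a : A F H => a \*l x).
Proof. by move=> c a a'; rewrite /lmul dgen_linl linearP. Qed.

Lemma lmul_linr F H G (a : A F H) : linear (fun x : P H G => a \*l x).
Proof. by move=> c x x'; rewrite /lmul dgen_linr linearP. Qed.

Lemma rmul_linl F H G (b : B H G) : linear (fun x : P F H => x \*r b).
Proof. by move=> c x x'; rewrite /rmul dgen_linl linearP. Qed.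

Lemma rmul_linr F H G (x : P F H) : linear (fun b : B H G => x \*r b).
Proof. by move=> c b b'; rewrite /rmul dgen_linr linearP. Qed.

Lemma lmul_str L F H G (a : A F H) (x : P H G) :
  tstr P L (a \*l x) = tstr A L a \*l tstr P L x.
Proof. by rewrite /lmul -tm_str tstr_diaE. Qed.

Lemma rmul_str L F H G (x : P F H) (b : B H G) :
  tstr P L (x \*r b) = tstr P L x \*r tstr B L b.
Proof. by rewrite /rmul -tm_str tstr_diaE. Qed.

Lemma tmap_act F F' G G' (f : hom F' F) (g : hom G G') (x : P F G) :
  tmap P f g x = tm (munit A) f \*l (x \*r tm (munit B) g).
Proof. by rewrite /rmul ract1 /lmul lact1 -tmap_comp !comp1m. Qed.

End Bimodule.

Section RelativeTensor.

Variables (A B D : tmonoid C) (P : bimod A B) (Q : bimod B D).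

Definition rten F H G (x : P F H) (y : Q H G) : rel_tensor P Q F G :=
  rt_class P Q F G (x \dt y).

Lemma rten_bal F H K G (x : P F H) (b : B H K) (y : Q K G) :
  rten (x \*r b) y = rten x (b \*l y).
Proof. exact: rt_classE. Qed.

Lemma rten_linl F H G (y : Q H G) : linear (fun x : P F H => rten x y).
Proof. by move=> c x x'; rewrite /rten dgen_linl linearP. Qed.

Lemma rten_linr F H G (x : P F H) : linear (fun y : Q H G => rten x y).
Proof. by move=> c x' y; rewrite /rten dgen_linr linearP. Qed.

Lemma rten_lmul F H K G (a : A F H) (x : P H K) (y : Q K G) :
  a \*l rten x y = rten (a \*l x) y.
Proof. exact: rt_lactE. Qed.

Lemma rten_rmul F H K G (x : P F H) (y : Q H K) (d : D K G) :
  rten x y \*r d = rten x (y \*r d).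
Proof. exact: rt_ractE. Qed.

Lemma rten_str L F H G (x : P F H) (y : Q H G) :
  tstr (rel_tensor P Q) L (rten x y) = rten (tstr P L x) (tstr Q L y).
Proof. by rewrite /rten tstr_rtE tstr_diaE. Qed.

Lemma rten_span F G (w : rel_tensor P Q F G) :
  exists r : seq (tens P Q F G),
    w = \sum_(s <- r) rten (projT2 s).1 (projT2 s).2.
Proof.
elim/pres_ind: w => [|x y [r ->] [r' ->]|c x [r ->]|z].
- by exists [::]; rewrite big_nil.
- by exists (r ++ r'); rewrite big_cat.
- exists [seq existT _ (projT1 s) (c *: (projT2 s).1, (projT2 s).2)
    : tens P Q F G | s <- r].
  rewrite big_map scaler_sumr; apply: eq_bigr => s _ /=.
  by rewrite (linZ (rten_linl _)).
- have [r zE] := dia_span z; exists r.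
  by rewrite -(lin_sum (rt_class_linear (F := F) (G := G))) -zE.
Qed.

Section Descent.

Variables (F G : C) (V : lmodType k) (b : forall H, P F H -> Q H G -> V).
Hypothesis b_linl : forall H (y : Q H G), linear (fun x : P F H => b x y).
Hypothesis b_linr : forall H (x : P F H), linear (fun y : Q H G => b x y).
Hypothesis b_bal : forall H K (x : P F H) (c : B H K) (y : Q K G),
  b (x \*r c) y = b x (c \*l y).

(** Dinaturality over the base category is balancedness over the image of the
    unit of the monoid, so balancedness over the monoid is all that a map out
    of a relative tensor product has to satisfy. *)
Lemma desc_balanced : balanced b.
Proof.
split=> // H H' h x y.
have := b_bal x (tm (munit B) h) y.
by rewrite /rmul ract1 /lmul lact1.
Qed.

Lemma desc_compat : rt_compat (dia_lift desc_balanced).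
Proof. by move=> H K x c y; rewrite !dia_liftE; exact: b_bal. Qed.

Definition rten_desc : {linear rel_tensor P Q F G -> V} :=
  rt_lift desc_compat.

Lemma rten_descE H (x : P F H) (y : Q H G) : rten_desc (rten x y) = b x y.
Proof. by rewrite /rten_desc /rten rt_liftE dia_liftE. Qed.

End Descent.

End RelativeTensor.

End ActionTheory.

(** * Morita contexts *)

Section Pairings.

Variables (k : fieldType) (C : moncat k) (A B : tmonoid C).
Variables (P : bimod A B) (Q : bimod B A).

(** A morphism of A-A-bimodules from the relative tensor product of P and Q to
    A, described by its values on pure tensors. *)
Record pairing : Type := Pairing {
  pr : forall F H G, P F H -> Q H G -> A F G;
  pr_linl : forall F H G (y : Q H G), linear (fun x : P F H => pr x y);
  pr_linr : forall F H G (x : P F H), linear (fun y : Q H G => pr x y);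
  pr_bal : forall F H K G (x : P F H) (b : B H K) (y : Q K G),
    pr (x \*r b) y = pr x (b \*l y);
  pr_lmul : forall F H K G (a : A F H) (x : P H K) (y : Q K G),
    pr (a \*l x) y = a \*m pr x y;
  pr_rmul : forall F H K G (x : P F H) (y : Q H K) (a : A K G),
    pr x (y \*r a) = pr x y \*m a;
  pr_str : forall L F H G (x : P F H) (y : Q H G),
    pr (tstr P L x) (tstr Q L y) = tstr A L (pr x y)
}.

End Pairings.

Arguments pr {k C A B P Q} p {F H G} x y : rename.

(** Since the image of a pairing is a two-sided ideal, this amounts to its
    surjectivity. *)
Definition pr_onto (k : fieldType) (C : moncat k) (A B : tmonoid C)
    (P : bimod A B) (Q : bimod B A) (p : pairing P Q) : Prop :=
  forall F, exists r : seq (tens P Q F F),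
    \sum_(s <- r) pr p (projT2 s).1 (projT2 s).2 = mon_one A F.

Record morita_context (k : fieldType) (C : moncat k) (A B : tmonoid C) : Type :=
  MoritaContext {
  ctxP : bimod A B;
  ctxQ : bimod B A;
  ctx_mu : pairing ctxP ctxQ;
  ctx_nu : pairing ctxQ ctxP;
  ctx_mu_onto : pr_onto ctx_mu;
  ctx_nu_onto : pr_onto ctx_nu;
  ctx_assocP : forall F H K G (x : ctxP F H) (y : ctxQ H K) (z : ctxP K G),
    pr ctx_mu x y \*l z = x \*r pr ctx_nu y z;
  ctx_assocQ : forall F H K G (y : ctxQ F H) (x : ctxP H K) (z : ctxQ K G),
    pr ctx_nu y x \*l z = y \*r pr ctx_mu x z
}.

Definition context_sym (k : fieldType) (C : moncat k) (A B : tmonoid C)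
    (c : morita_context A B) : morita_context B A :=
  MoritaContext (ctx_nu_onto c) (ctx_mu_onto c)
    (@ctx_assocQ _ _ _ _ c) (@ctx_assocP _ _ _ _ c).

Section ContextIso.

Variables (k : fieldType) (C : moncat k) (A B : tmonoid C).
Variable c : morita_context A B.

Let P := ctxP c.
Let Q := ctxQ c.
Let mu F H G (x : P F H) (y : Q H G) : A F G := pr (ctx_mu c) x y.
Let nu F H G (y : Q F H) (x : P H G) : B F G := pr (ctx_nu c) y x.

Definition ctx_map F G : {linear rel_tensor P Q F G -> A F G} :=
  rten_desc (@pr_linl _ _ _ _ _ _ (ctx_mu c) F ^~ G)
    (@pr_linr _ _ _ _ _ _ (ctx_mu c) F ^~ G)
    (fun H K => @pr_bal _ _ _ _ _ _ (ctx_mu c) F H K G).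

Arguments ctx_map : simpl never.

Lemma ctx_mapE F H G (x : P F H) (y : Q H G) : ctx_map F G (rten x y) = mu x y.
Proof. exact: rten_descE. Qed.

Lemma ctx_map_lmul F H G (a : A F H) (w : rel_tensor P Q H G) :
  ctx_map F G (a \*l w) = a \*m ctx_map H G w.
Proof.
have [r ->] := rten_span w.
rewrite (lin_sum (lmul_linr a)) !linear_sum (lin_sum (mon_mul_linr a)).
by apply: eq_bigr => s _; rewrite rten_lmul !ctx_mapE /mu pr_lmul.
Qed.

Lemma ctx_map_rmul F H G (w : rel_tensor P Q F H) (a : A H G) :
  ctx_map F G (w \*r a) = ctx_map F H w \*m a.
Proof.
have [r ->] := rten_span w.
rewrite (lin_sum (rmul_linl a)) !linear_sum (lin_sum (mon_mul_linl a)).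
by apply: eq_bigr => s _; rewrite rten_rmul !ctx_mapE /mu pr_rmul.
Qed.

Lemma ctx_map_str L F G (w : rel_tensor P Q F G) :
  ctx_map (L \ot F) (L \ot G) (tstr (rel_tensor P Q) L w) =
  tstr A L (ctx_map F G w).
Proof.
have [r ->] := rten_span w; rewrite !linear_sum.
by apply: eq_bigr => s _; rewrite rten_str !ctx_mapE /mu pr_str.
Qed.

(** On w = x (x) y, associativity and balancedness move each y_s mu(x, y) =
    nu(y_s, x) y across the tensor sign, leaving the mu(x_s, y_s) x, whose sum
    is x. *)
Lemma ctx_map_reproduce F G (r : seq (tens P Q F F)) (w : rel_tensor P Q F G) :
  \sum_(s <- r) mu (projT2 s).1 (projT2 s).2 = mon_one A F ->
  w = \sum_(s <- r) rten (projT2 s).1 ((projT2 s).2 \*r ctx_map F G w).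
Proof.
move=> rE; have [r' ->] := rten_span w; rewrite !linear_sum.
under [RHS]eq_bigr => s _ do
  rewrite (lin_sum (rmul_linr _)) (lin_sum (rten_linr _)).
rewrite exchange_big; apply: eq_bigr => t _.
set x := (projT2 t).1; set y := (projT2 t).2.
have xE : x = \sum_(s <- r) (mu (projT2 s).1 (projT2 s).2 \*l x).
  by rewrite -(lin_sum (lmul_linl x)) rE lmul1.
rewrite [in LHS]xE (lin_sum (rten_linl y)); apply: eq_bigr => s _.
by rewrite ctx_mapE -ctx_assocQ -rten_bal ctx_assocP.
Qed.

(** The inverse sends a to the sum of the x_s (x) (y_s a), where the identity is
    the sum of the mu(x_s, y_s). *)
Lemma ctx_map_bij F G : bijective (ctx_map F G).
Proof.
have [r rE] := ctx_mu_onto c F.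
pose g (a : A F G) : rel_tensor P Q F G :=
  \sum_(s <- r) rten (projT2 s).1 ((projT2 s).2 \*r a).
exists g => [w | a]; first exact: esym (ctx_map_reproduce w rE).
rewrite linear_sum; under eq_bigr => s _ do rewrite ctx_mapE /mu pr_rmul.
by rewrite -(lin_sum (mon_mul_linl a)) rE mon_mul1m.
Qed.

Lemma ctx_map_nat F F' G G' (f : hom F' F) (g : hom G G')
    (w : rel_tensor P Q F G) :
  ctx_map F' G' (tmap (rel_tensor P Q) f g w) = tmap A f g (ctx_map F G w).
Proof.
rewrite (tmap_act f g w) ctx_map_lmul ctx_map_rmul.
exact: esym (@tmap_act _ _ _ _ (regular_bimod A) _ _ _ _ f g (ctx_map F G w)).
Qed.

Definition ctx_tmor : tmor (rel_tensor P Q) (regular_bimod A) :=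
  @TMor _ _ (rel_tensor P Q) (regular_bimod A) ctx_map ctx_map_nat ctx_map_str.

End ContextIso.

Section InverseMorphism.

Variables (k : fieldType) (C : moncat k) (S T : tambara C) (u : tmor S T).
Hypothesis u_bij : forall F G, bijective (@tm _ _ _ _ u F G).

Lemma tmor_inverse :
  exists v : tmor T S,
    (forall F G (x : S F G), tm v (tm u x) = x) /\
    (forall F G (y : T F G), tm u (tm v y) = y).
Proof.
have [g gE] : exists g : forall F G, T F G -> S F G, forall F G,
    cancel (@tm _ _ _ _ u F G) (g F G) /\ cancel (g F G) (@tm _ _ _ _ u F G).
  have h F G := cid (let: Bijective g K K' := u_bij F G in
    ex_intro (fun g => cancel (@tm _ _ _ _ u F G) g /\
                       cancel g (@tm _ _ _ _ u F G)) g (conj K K')).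
  by exists (fun F G => sval (h F G)) => F G; exact: (svalP (h F G)).
have uK F G : cancel (@tm _ _ _ _ u F G) (g F G) by have [] := gE F G.
have gK F G : cancel (g F G) (@tm _ _ _ _ u F G) by have [] := gE F G.
have gL F G : linear (g F G).
  by move=> a x y; apply: (can_inj (@uK F G)); rewrite linearP !gK.
have gN F F' G G' (f : hom F' F) (h : hom G G') (x : T F G) :
    mklinear (gL F' G') (tmap T f h x) = tmap S f h (mklinear (gL F G) x).
  by apply: (can_inj (@uK F' G')); rewrite tm_nat !mklinearE !gK.
have gS L F G (x : T F G) :
    mklinear (gL (L \ot F) (L \ot G)) (tstr T L x) =
    tstr S L (mklinear (gL F G) x).
  by apply: (can_inj (@uK _ _)); rewrite tm_str !mklinearE !gK.
by exists (TMor gN gS); split=> F G x /=; [exact: uK | exact: gK].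
Qed.

End InverseMorphism.

Lemma context_rel_tensor_iso (k : fieldType) (C : moncat k) (A B : tmonoid C)
    (c : morita_context A B) :
  bimod_isomorphic (rel_tensor (ctxP c) (ctxQ c)) (regular_bimod A).
Proof.
have [v [vK Kv]] := tmor_inverse (u := ctx_tmor c) (ctx_map_bij c).
exists (ctx_tmor c), v; split=> //.
- exact: ctx_map_lmul.
- exact: ctx_map_rmul.
Qed.

Lemma context_morita_equivalent (k : fieldType) (C : moncat k)
    (A B : tmonoid C) :
  morita_context A B -> morita_equivalent A B.
Proof.
move=> c; exists (ctxP c), (ctxQ c); split; first exact: context_rel_tensor_iso.
exact: (context_rel_tensor_iso (context_sym c)).
Qed.

(** * From a Morita equivalence to a Morita context *)

Section PairingOfIso.

Variables (k : fieldType) (C : moncat k) (A B : tmonoid C).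
Variables (P : bimod A B) (Q : bimod B A).
Variables (u : tmor (rel_tensor P Q) A) (v : tmor A (rel_tensor P Q)).
Hypothesis vK : forall F G (w : rel_tensor P Q F G), tm v (tm u w) = w.
Hypothesis uK : forall F G (a : A F G), tm u (tm v a) = a.
Hypothesis u_lmul : forall F H G (a : A F H) (w : rel_tensor P Q H G),
  tm u (a \*l w) = a \*m tm u w.
Hypothesis u_rmul : forall F H G (w : rel_tensor P Q F H) (a : A H G),
  tm u (w \*r a) = tm u w \*m a.

Program Definition iso_pairing : pairing P Q :=
  @Pairing _ _ _ _ P Q (fun F H G x y => tm u (rten x y)) _ _ _ _ _ _.
Next Obligation. by move=> F H G y c x x'; rewrite rten_linl linearP. Qed.
Next Obligation. by move=> F H G x c y y'; rewrite rten_linr linearP. Qed.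
Next Obligation. by move=> * /=; rewrite rten_bal. Qed.
Next Obligation. by move=> * /=; rewrite -rten_lmul u_lmul. Qed.
Next Obligation. by move=> * /=; rewrite -rten_rmul u_rmul. Qed.
Next Obligation. by move=> * /=; rewrite -rten_str tm_str. Qed.

Lemma iso_pairing_onto : pr_onto iso_pairing.
Proof.
move=> F; have [r rE] := rten_span (tm v (mon_one A F)).
by exists r; rewrite -[RHS]uK rE linear_sum.
Qed.

Lemma iso_v_lmul F H G (a : A F H) (b : A H G) :
  tm v (a \*m b) = a \*l tm v b.
Proof. by rewrite -[RHS]vK u_lmul uK. Qed.

Lemma iso_v_rmul F H G (a : A F H) (b : A H G) :
  tm v (a \*m b) = tm v a \*r b.
Proof. by rewrite -[RHS]vK u_rmul uK. Qed.

(** Both sides have the same image mu(x, y) mu(z, y') under the isomorphism. *)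
Lemma iso_pairing_shift F H K L G (x : P F H) (y : Q H K) (z : P K L)
    (y' : Q L G) :
  rten x (y \*r pr iso_pairing z y') = rten (pr iso_pairing x y \*l z) y'.
Proof.
by rewrite -[LHS]vK -[RHS]vK -rten_rmul -rten_lmul u_rmul u_lmul.
Qed.

End PairingOfIso.

(** Two unrelated isomorphisms mu : P (x) Q -> A and nu0 : Q (x) P -> B determine
    an automorphism theta of P by theta(mu(x, y) z) = x nu0(y, z), which is the
    obstruction to associativity.  If the identity of B is the sum of the
    nu0(y_t, x_t), then the inverse of theta sends x to the sum of the
    mu(x, y_t) x_t.  Hence nu0(y, theta^-1 x) is the sum of the
    nu0(y mu(x, y_t), x_t), that is, the value of [twist y x] below at the element
    of Q (x) P that nu0 sends to the identity.  As [twist y x] is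
    defined on the whole relative tensor product, the y_t and x_t need not be
    chosen. *)
Section ContextOfMorita.

Variables (k : fieldType) (C : moncat k) (A B : tmonoid C).
Variables (P : bimod A B) (Q : bimod B A).
Variables (u1 : tmor (rel_tensor P Q) A) (v1 : tmor A (rel_tensor P Q)).
Variables (u2 : tmor (rel_tensor Q P) B) (v2 : tmor B (rel_tensor Q P)).
Hypothesis v1K : forall F G (w : rel_tensor P Q F G), tm v1 (tm u1 w) = w.
Hypothesis u1K : forall F G (a : A F G), tm u1 (tm v1 a) = a.
Hypothesis u1_lmul : forall F H G (a : A F H) (w : rel_tensor P Q H G),
  tm u1 (a \*l w) = a \*m tm u1 w.
Hypothesis u1_rmul : forall F H G (w : rel_tensor P Q F H) (a : A H G),
  tm u1 (w \*r a) = tm u1 w \*m a.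
Hypothesis v2K : forall F G (w : rel_tensor Q P F G), tm v2 (tm u2 w) = w.
Hypothesis u2K : forall F G (b : B F G), tm u2 (tm v2 b) = b.
Hypothesis u2_lmul : forall F H G (b : B F H) (w : rel_tensor Q P H G),
  tm u2 (b \*l w) = b \*m tm u2 w.
Hypothesis u2_rmul : forall F H G (w : rel_tensor Q P F H) (b : B H G),
  tm u2 (w \*r b) = tm u2 w \*m b.

Let mu : pairing P Q := iso_pairing u1_lmul u1_rmul.
Let nu0 : pairing Q P := iso_pairing u2_lmul u2_rmul.

Let mu_onto : pr_onto mu := iso_pairing_onto u1K u1_lmul u1_rmul.
Let nu0_onto : pr_onto nu0 := iso_pairing_onto u2K u2_lmul u2_rmul.

Section Twist.

Variables (F H G : C) (y : Q F H) (x : P H G).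

Lemma twist_linl K L (x' : P L K) :
  linear (fun y' : Q G L => pr nu0 (y \*r pr mu x y') x').
Proof. by move=> c y1 y2; rewrite pr_linr rmul_linr pr_linl. Qed.

Lemma twist_linr K L (y' : Q G L) :
  linear (fun x' : P L K => pr nu0 (y \*r pr mu x y') x').
Proof. exact: pr_linr. Qed.

Lemma twist_bal K L L' (y' : Q G L) (a : A L L') (x' : P L' K) :
  pr nu0 (y \*r pr mu x (y' \*r a)) x' =
  pr nu0 (y \*r pr mu x y') (a \*l x').
Proof. by rewrite pr_rmul rmulA pr_bal. Qed.

Definition twist K : {linear rel_tensor Q P G K -> B F K} :=
  rten_desc (@twist_linl K) (@twist_linr K) (@twist_bal K).

Lemma twistE K L (y' : Q G L) (x' : P L K) :
  twist K (rten y' x') = pr nu0 (y \*r pr mu x y') x'.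
Proof. exact: rten_descE. Qed.

End Twist.

Arguments twist : simpl never.

Lemma twist_linP F H G K (x : P H G) (w : rel_tensor Q P G K) :
  linear (fun y : Q F H => twist y x K w).
Proof.
move=> c y y'; have [r ->] := rten_span w.
rewrite !linear_sum -big_split; apply: eq_bigr => s _.
by rewrite !twistE rmul_linl pr_linl.
Qed.

Lemma twist_linQ F H G K (y : Q F H) (w : rel_tensor Q P G K) :
  linear (fun x : P H G => twist y x K w).
Proof.
move=> c x x'; have [r ->] := rten_span w.
rewrite !linear_sum -big_split; apply: eq_bigr => s _.
by rewrite !twistE pr_linl rmul_linr pr_linl.
Qed.

Lemma twist_bal_mid F H H' G K (y : Q F H) (a : A H H') (x : P H' G)
    (w : rel_tensor Q P G K) :
  twist (y \*r a) x K w = twist y (a \*l x) K w.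
Proof.
have [r ->] := rten_span w; rewrite !linear_sum; apply: eq_bigr => s _.
by rewrite !twistE pr_lmul rmulA.
Qed.

Lemma twist_lmul F H L G K (b : B F H) (y : Q H L) (x : P L G)
    (w : rel_tensor Q P G K) :
  twist (b \*l y) x K w = b \*m twist y x K w.
Proof.
have [r ->] := rten_span w.
rewrite !linear_sum (lin_sum (mon_mul_linr b)); apply: eq_bigr => s _.
by rewrite !twistE lrmulA pr_lmul.
Qed.

Lemma twist_shift F H G G' K (y : Q F H) (x : P H G) (b : B G G')
    (w : rel_tensor Q P G' K) :
  twist y (x \*r b) K w = twist y x K (b \*l w).
Proof.
have [r ->] := rten_span w.
rewrite (lin_sum (lmul_linr b)) !linear_sum; apply: eq_bigr => s _.
by rewrite rten_lmul !twistE [pr mu _ _]pr_bal.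
Qed.

Lemma twist_rmul F H G K K' (y : Q F H) (x : P H G)
    (w : rel_tensor Q P G K) (b : B K K') :
  twist y x K' (w \*r b) = twist y x K w \*m b.
Proof.
have [r ->] := rten_span w.
rewrite (lin_sum (rmul_linl b)) !linear_sum (lin_sum (mon_mul_linl b)).
by apply: eq_bigr => s _; rewrite rten_rmul !twistE pr_rmul.
Qed.

Lemma twist_str L F H G K (y : Q F H) (x : P H G) (w : rel_tensor Q P G K) :
  twist (tstr Q L y) (tstr P L x) (L \ot K) (tstr (rel_tensor Q P) L w) =
  tstr B L (twist y x K w).
Proof.
have [r ->] := rten_span w; rewrite !linear_sum; apply: eq_bigr => s _.
by rewrite rten_str !twistE pr_str -rmul_str pr_str.
Qed.

(** The preimage of the identity is central, which makes the corrected pairing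
    right linear. *)
Lemma iso_v2_one_comm G G' (b : B G G') :
  b \*l tm v2 (mon_one B G') = tm v2 (mon_one B G) \*r b.
Proof.
rewrite -(iso_v_lmul v2K u2K u2_lmul) -(iso_v_rmul v2K u2K u2_rmul).
by rewrite mon_mulm1 mon_mul1m.
Qed.

Definition corrected_nu F H G (y : Q F H) (x : P H G) : B F G :=
  twist y x G (tm v2 (mon_one B G)).

Program Definition corrected_pairing : pairing Q P :=
  @Pairing _ _ _ _ Q P corrected_nu _ _ _ _ _ _.
Next Obligation. by move=> F H G x; exact: twist_linP. Qed.
Next Obligation. by move=> F H G y; exact: twist_linQ. Qed.
Next Obligation. by move=> *; exact: twist_bal_mid. Qed.
Next Obligation. by move=> *; exact: twist_lmul. Qed.
Next Obligation.
move=> F H K G y x b; rewrite /corrected_nu twist_shift iso_v2_one_comm.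
exact: twist_rmul.
Qed.
Next Obligation.
by move=> L F H G y x; rewrite /corrected_nu -mon_one_str tm_str twist_str.
Qed.

Local Notation nu := corrected_pairing.

(** This is nu(y, theta z) = nu0(y, z) for z = mu(x, y') x'. *)
Lemma corrected_pairingE F H G L G' (y : Q F H) (x : P H G) (y' : Q G L)
    (x' : P L G') :
  pr nu y (x \*r pr nu0 y' x') = pr nu0 (y \*r pr mu x y') x'.
Proof.
rewrite [LHS]/(pr _ _ _) /= /corrected_nu twist_shift.
rewrite -(iso_v_lmul v2K u2K u2_lmul) mon_mulm1.
by rewrite v2K twistE.
Qed.

(** For every w in Q (x) P one has x twist_(y, z)(w) = mu(x, y) z nu0(w), because
    on w = y' (x) x' this is the image of [iso_pairing_shift] under
    x (x) y |-> x nu0(y, x').  The value at the preimage of the identity is the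
    claim. *)
Lemma corrected_assocP F H K G (x : P F H) (y : Q H K) (z : P K G) :
  pr mu x y \*l z = x \*r pr nu y z.
Proof.
have shift L G' (y' : Q G L) (x' : P L G') :
    x \*r pr nu0 (y \*r pr mu z y') x' =
    (pr mu x y \*l z) \*r pr nu0 y' x'.
  have bl H' (t : Q H' L) : linear (fun t' : P F H' => t' \*r pr nu0 t x').
    exact: rmul_linl.
  have br H' (t' : P F H') : linear (fun t : Q H' L => t' \*r pr nu0 t x').
    by move=> c t1 t2; rewrite pr_linl rmul_linr.
  have bb H' K' (t' : P F H') (b : B H' K') (t : Q K' L) :
      (t' \*r b) \*r pr nu0 t x' = t' \*r pr nu0 (b \*l t) x'.
    by rewrite pr_lmul rmulA.
  have E := iso_pairing_shift v1K u1_lmul u1_rmul x y z y'.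
  have := congr1 (rten_desc bl br bb) E.
  by rewrite !rten_descE.
have gen w : x \*r twist y z G w = (pr mu x y \*l z) \*r tm u2 w.
  have [r ->] := rten_span w.
  rewrite !linear_sum !(lin_sum (rmul_linr _)); apply: eq_bigr => s _.
  by rewrite twistE shift.
by rewrite gen u2K rmul1.
Qed.

(** Each nu0(y, x) is a sum of values of the corrected pairing, by
    [corrected_pairingE] and an expression of the identity of A through mu. *)
Lemma corrected_pairing_onto : pr_onto nu.
Proof.
move=> G; have [r rE] := nu0_onto G.
have onto F (y : Q G F) (x : P F G) : exists r' : seq (tens Q P G G),
    \sum_(s <- r') pr nu (projT2 s).1 (projT2 s).2 = pr nu0 y x.
  have [r' r'E] := mu_onto F.
  (* nu0(y, x) is the sum of the nu(y, x_s nu0(y_s, x)), where the identity is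
     the sum of the mu(x_s, y_s) *)
  exists [seq existT _ F (y, (projT2 s).1 \*r pr nu0 (projT2 s).2 x)
    : tens Q P G G | s <- r'].
  rewrite big_map.
  transitivity (\sum_(s <- r')
      pr nu0 (y \*r pr mu (projT2 s).1 (projT2 s).2) x).
    by apply: eq_bigr => s _; exact: corrected_pairingE.
  rewrite -(lin_sum (@pr_linl _ _ _ _ _ _ nu0 _ _ _ x)).
  by rewrite -(lin_sum (rmul_linr y)) r'E rmul1.
rewrite -rE; elim: r {rE} => [|s r [r' IH]]; first by exists [::]; rewrite !big_nil.
have [r'' E] := onto _ (projT2 s).1 (projT2 s).2.
by exists (r'' ++ r'); rewrite big_cat big_cons /= IH E.
Qed.

(** The two sides pair equally with every element of P by the associativity
    already obtained, and the corrected pairing is nondegenerate: if d pairs to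
    zero with P then so it does under nu0, hence d (x) t = 0 for all t in P, hence
    d mu(t, t') = 0 for all t and t', and the identity is a sum of values of mu. *)
Lemma corrected_assocQ F H K G (y : Q F H) (x : P H K) (z : Q K G) :
  pr nu y x \*l z = y \*r pr mu x z.
Proof.
apply/eqP; rewrite -subr_eq0; apply/eqP; set d := _ - _.
have d_nu K' (t : P G K') : pr nu d t = 0.
  rewrite (linB (@pr_linl _ _ _ _ _ _ nu _ _ _ t)).
  by rewrite pr_lmul -pr_rmul -corrected_assocP pr_bal subrr.
have d_nu0 K' (t : P G K') : pr nu0 d t = 0.
  have [r rE] := mu_onto G.
  rewrite -[d]rmul1 -rE (lin_sum (rmul_linr d)).
  rewrite (lin_sum (@pr_linl _ _ _ _ _ _ nu0 _ _ _ t)).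
  by apply: big1 => s _; rewrite -corrected_pairingE d_nu.
have d_rten K' (t : P G K') : rten d t = 0 :> rel_tensor Q P F K'.
  by rewrite -[LHS]v2K [tm u2 _]d_nu0 linear0.
have d_mu K' (t : P G K') (t' : Q K' G) : d \*r pr mu t t' = 0.
  have bl H' (w : P H' K') : linear (fun w' : Q F H' => w' \*r pr mu w t').
    exact: rmul_linl.
  have br H' (w' : Q F H') : linear (fun w : P H' K' => w' \*r pr mu w t').
    by move=> c w1 w2; rewrite pr_linl rmul_linr.
  have bb H' L' (w' : Q F H') (a : A H' L') (w : P L' K') :
      (w' \*r a) \*r pr mu w t' = w' \*r pr mu (a \*l w) t'.
    by rewrite pr_lmul rmulA.
  by have := rten_descE bl br bb d t; rewrite d_rten linear0.
have [r rE] := mu_onto G.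
rewrite -[d]rmul1 -rE (lin_sum (rmul_linr d)).
by apply: big1 => s _.
Qed.

Definition context_of_isos : morita_context A B :=
  MoritaContext mu_onto corrected_pairing_onto corrected_assocP corrected_assocQ.

End ContextOfMorita.

Lemma morita_equivalent_context (k : fieldType) (C : moncat k)
    (A B : tmonoid C) :
  morita_equivalent A B -> inhabited (morita_context A B).
Proof.
move=> [P [Q [[u1 [v1 [v1K u1K u1l u1r]]] [u2 [v2 [v2K u2K u2l u2r]]]]]].
by constructor; exact: (@context_of_isos _ _ _ _ P Q u1 v1 u2 v2).
Qed.

(** * Fully faithful functors and retracts *)

Section Cancellation.

Variables (k : fieldType) (D : lincat k).

Lemma comp_bwdK (a b c : D) (i : iso a b) (f : hom c a) :
  bwd i \oc (fwd i \oc f) = f.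
Proof. by rewrite compA bwdK comp1m. Qed.

Lemma comp_fwdK (a b c : D) (i : iso a b) (f : hom c b) :
  fwd i \oc (bwd i \oc f) = f.
Proof. by rewrite compA fwdK comp1m. Qed.

Lemma comp_suml (a b c : D) I (r : seq I) (g : I -> hom b c) (f : hom a b) :
  (\sum_(i <- r) g i) \oc f = \sum_(i <- r) g i \oc f.
Proof. exact: (lin_sum (comp_linl f)). Qed.

Lemma comp_sumr (a b c : D) I (r : seq I) (g : hom b c) (f : I -> hom a b) :
  g \oc (\sum_(i <- r) f i) = \sum_(i <- r) g \oc f i.
Proof. exact: (lin_sum (comp_linr g)). Qed.

End Cancellation.

Section FullyFaithful.

Variables (k : fieldType) (D D' : lincat k) (E : functor D D').
Hypothesis E_inj : forall a b, injective (@fmap _ _ _ E a b).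
Hypothesis E_surj : forall a b (g : hom (E a) (E b)), exists f, fmap E f = g.

Lemma preimage_exists :
  exists pre : forall a b, hom (E a) (E b) -> hom a b,
    forall a b (g : hom (E a) (E b)), fmap E (pre a b g) = g.
Proof.
exists (fun a b g => sval (cid (E_surj g))) => a b g.
exact: (svalP (cid (E_surj g))).
Qed.

Lemma ff_equivalence :
  (forall d : D', exists c : D, inhabited (iso (E c) d)) -> is_equivalence E.
Proof.
move=> E_es; have [pre preK] := preimage_exists.
have pick d : {c : D & iso (E c) d}.
  have [c cP] := cid (E_es d); exists c.
  by have [i _] := cid (let: inhabits i := cP in ex_intro (fun _ => True) i I).
pose Go d := projT1 (pick d).
pose eps d : iso (E (Go d)) d := projT2 (pick d).
pose Gm d d' (g : hom d d') := pre _ _ (bwd (eps d') \oc g \oc fwd (eps d)).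
have GmE d d' (g : hom d d') :
    fmap E (Gm d d' g) = bwd (eps d') \oc g \oc fwd (eps d) by exact: preK.
have Gm_lin d d' : linear (Gm d d').
  move=> a g g'; apply: E_inj.
  by rewrite linearP !GmE comp_linr comp_linl.
have Gm1 d : mklinear (Gm_lin d d) (idm d) = idm (Go d).
  by apply: E_inj; rewrite mklinearE GmE compm1 bwdK fmap_id.
have GmM d d' d'' (g : hom d' d'') (f : hom d d') :
    mklinear (Gm_lin d d'') (g \oc f) =
    mklinear (Gm_lin d' d'') g \oc mklinear (Gm_lin d d') f.
  by apply: E_inj; rewrite !mklinearE fmap_comp !GmE -!compA comp_fwdK.
pose G := Functor Gm1 GmM.
exists G; split; constructor.
- pose f c := pre _ _ (fwd (eps (E c))); pose b c := pre _ _ (bwd (eps (E c))).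
  have bf c : b c \oc f c = idm _.
    by apply: E_inj; rewrite fmap_comp !preK bwdK fmap_id.
  have fb c : f c \oc b c = idm _.
    by apply: E_inj; rewrite fmap_comp !preK fwdK fmap_id.
  apply: (@NatIso _ _ _ (comp_functor G E) (id_functor D)
    (fun c => Iso (bf c) (fb c))) => c c' h.
  apply: E_inj; rewrite /= !fmap_comp !preK.
  by rewrite -compA comp_fwdK.
- apply: (@NatIso _ _ _ (comp_functor E G) (id_functor D') eps) => d d' g.
  by rewrite /= GmE -compA comp_fwdK.
Qed.

(** A retract of E c is cut out by an idempotent of E c, which comes from an
    idempotent of c; splitting the latter gives the required preimage. *)
Lemma ff_retract_equivalence :
  idempotent_split D ->
  (forall d : D', exists c : D, is_direct_summand d (E c)) -> is_equivalence E.
Proof.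
move=> split_D E_ret; apply: ff_equivalence => d.
have [c [i [p pi]]] := E_ret d.
have [e eE] := E_surj (i \oc p).
have ee : e \oc e = e.
  by apply: E_inj; rewrite fmap_comp eE -compA (compA p) pi comp1m.
have [c' [j [q [qj jq]]]] := split_D c e ee.
have bf : (fmap E q \oc i) \oc (p \oc fmap E j) = idm _.
  rewrite -compA (compA i) -eE -jq fmap_comp -!compA.
  by rewrite -fmap_comp qj fmap_id compm1 -fmap_comp qj fmap_id.
have fb : (p \oc fmap E j) \oc (fmap E q \oc i) = idm _.
  by rewrite -compA (compA (fmap E j)) -fmap_comp jq eE -compA pi compm1 pi.
by exists c'; constructor; exact: (Iso bf fb).
Qed.

End FullyFaithful.

(** * The linking category of a Morita context *)

Section Link.

Variables (k : fieldType) (C : moncat k) (A B : tmonoid C).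
Variable c : morita_context A B.

Definition link_hom (s t : C + C) : lmodType k :=
  match s, t with
  | inl F, inl G => A F G
  | inl F, inr G => ctxP c F G
  | inr F, inl G => ctxQ c F G
  | inr F, inr G => B F G
  end.

Definition link_id (s : C + C) : link_hom s s :=
  match s with
  | inl F => mon_one A F
  | inr F => mon_one B F
  end.

Definition link_comp (s t u : C + C) :
    link_hom t u -> link_hom s t -> link_hom s u :=
  match s, t, u return link_hom t u -> link_hom s t -> link_hom s u with
  | inl _, inl _, inl _ => fun g f => f \*m g
  | inl _, inl _, inr _ => fun g f => f \*l g
  | inl _, inr _, inl _ => fun g f => pr (ctx_mu c) f g
  | inl _, inr _, inr _ => fun g f => f \*r g
  | inr _, inl _, inl _ => fun g f => f \*r g
  | inr _, inl _, inr _ => fun g f => pr (ctx_nu c) f g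
  | inr _, inr _, inl _ => fun g f => f \*l g
  | inr _, inr _, inr _ => fun g f => f \*m g
  end.

(** The monoids and the bimodules of a context fit into one category on two
    copies of the objects of the base, in which the laws of modules and the
    balancedness and associativity of the pairings all become associativity of
    composition. *)
Program Definition link : lincat k :=
  @LinCat k (C + C)%type link_hom link_id link_comp _ _ _ _ _.
Next Obligation.
by move=> [F|F] [G|G] f /=;
  rewrite ?mon_mulm1 ?rmul1.
Qed.
Next Obligation.
by move=> [F|F] [G|G] f /=; rewrite ?mon_mul1m ?lmul1.
Qed.
Next Obligation.
move=> [F|F] [H|H] [K|K] [G|G] h g f /=;
  by rewrite ?mon_mulA ?lmulA ?rmulA ?lrmulA ?pr_lmul ?pr_rmul ?pr_bal
    ?ctx_assocP ?ctx_assocQ.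
Qed.
Next Obligation.
move=> [F|F] [H|H] [G|G] f /=; first [exact: mon_mul_linr | exact: lmul_linr
  | exact: rmul_linr | exact: pr_linr].
Qed.
Next Obligation.
move=> [F|F] [H|H] [G|G] g /=; first [exact: mon_mul_linl | exact: lmul_linl
  | exact: rmul_linl | exact: pr_linl].
Qed.

Definition link_act (L : C) (s : C + C) : C + C :=
  match s with
  | inl F => inl (L \ot F)
  | inr F => inr (L \ot F)
  end.

Definition link_str_fun (L : C) (s t : C + C) :
    link_hom s t -> link_hom (link_act L s) (link_act L t) :=
  match s, t
    return link_hom s t -> link_hom (link_act L s) (link_act L t) with
  | inl _, inl _ => tstr A L
  | inl _, inr _ => tstr (ctxP c) L
  | inr _, inl _ => tstr (ctxQ c) L
  | inr _, inr _ => tstr B L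
  end.

Definition link_str (L : C) (s t : link) (f : hom s t) :
    @hom k link (link_act L s) (link_act L t) := link_str_fun L f.

Lemma link_str_comp L (s t u : link) (g : hom t u) (f : hom s t) :
  link_str L (g \oc f) = link_str L g \oc link_str L f.
Proof.
move: s t u g f => [F|F] [H|H] [G|G] g f; rewrite /link_str /=;
  by rewrite ?mon_mul_str ?lmul_str ?rmul_str ?pr_str.
Qed.

End Link.

(** * Realizing objects of one module category in the other *)

Section Frames.

Variables (k : fieldType) (C : moncat k) (M : modcat C) (X : M).

(** A composite Z -> F X -> Z together with a datum T F, which will describe a
    summand of the identity of F X. *)
Record frame (T : C -> Type) (Z : M) : Type := Frame {
  fr_ob : C;
  fr_p : hom (act fr_ob X) Z;
  fr_i : hom Z (act fr_ob X);
  fr_t : T fr_ob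
}.

(** Z is a retract of a direct sum of objects F X, so its identity is a sum of
    composites Z -> F X -> Z, in which the identities of the F X are expanded. *)
Lemma generator_frames (T : C -> Type)
    (w : forall F, T F -> hom (act F X) (act F X)) :
  is_cyclic_generator X ->
  (forall F, exists r : seq (T F), \sum_(t <- r) w F t = idm (act F X)) ->
  forall Z, exists r : seq (frame T Z),
    \sum_(s <- r) fr_p s \oc w _ (fr_t s) \oc fr_i s = idm Z.
Proof.
move=> X_gen w1 Z.
have [n [F [S [[inj [prj [_ _ sumE]]] [i [p pi]]]]]] := X_gen Z.
pose r j := sval (cid (w1 (F j))).
have rE j : \sum_(t <- r j) w _ t = idm _ := svalP (cid (w1 (F j))).
exists [seq Frame (p \oc inj j) (prj j \oc i) t | j <- enum 'I_n, t <- r j].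
rewrite big_allpairs_dep /= big_enum /=.
rewrite -pi -[p in RHS]compm1 -sumE comp_sumr comp_suml.
apply: eq_bigr => j _.
rewrite -[inj j in RHS]compm1 -rE comp_sumr comp_suml comp_sumr comp_suml.
by apply: eq_bigr => t _; rewrite !compA.
Qed.

End Frames.

Arguments fr_ob {k C M X T Z} _.
Arguments fr_p {k C M X T Z} _.
Arguments fr_i {k C M X T Z} _.
Arguments fr_t {k C M X T Z} _.

Section EndMonoid.

Variables (k : fieldType) (C : moncat k) (M : modcat C) (X : M).

Lemma end_mulE F H G (a : end_monoid X F H) (b : end_monoid X H G) :
  a \*m b = b \oc a.
Proof. by rewrite /mon_mul dia_tmorE. Qed.

Lemma end_oneE F : mon_one (end_monoid X) F = idm (act F X).
Proof. exact: actm_id. Qed.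

Definition act_conj L F G (a : hom (act F X) (act G X)) :
    hom (act (L \ot F) X) (act (L \ot G) X) :=
  fwd (mten L G X) \oc fmap (act L) a \oc bwd (mten L F X).

Lemma act_conjE L F G (a : hom (act F X) (act G X)) :
  act_conj L a \oc fwd (mten L F X) = fwd (mten L G X) \oc fmap (act L) a.
Proof. by rewrite /act_conj -compA bwdK compm1. Qed.

End EndMonoid.

Section Embeddings.

Variables (k : fieldType) (C : moncat k) (M N : modcat C) (X : M) (Y : N).
Variable c : morita_context (end_monoid X) (end_monoid Y).

Local Notation L := (link c).

(** The monoid of endomorphisms of X composes as M does, so the full subcategories
    of the linking category on the two copies of C are identified with full
    subcategories of M and N; these casts keep track of the passage. *)
Definition inA F G (a : hom (act F X) (act G X)) : @hom _ L (inl F) (inl G) := a.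
Definition outA F G (a : @hom _ L (inl F) (inl G)) : hom (act F X) (act G X) := a.
Definition inB F G (b : hom (act F Y) (act G Y)) : @hom _ L (inr F) (inr G) := b.
Definition outB F G (b : @hom _ L (inr F) (inr G)) : hom (act F Y) (act G Y) := b.

Arguments inA : simpl never.
Arguments outA : simpl never.
Arguments inB : simpl never.
Arguments outB : simpl never.

Lemma inAK F G a : outA (@inA F G a) = a. Proof. by []. Qed.
Lemma outAK F G a : inA (@outA F G a) = a. Proof. by []. Qed.
Lemma inBK F G b : outB (@inB F G b) = b. Proof. by []. Qed.
Lemma outBK F G b : inB (@outB F G b) = b. Proof. by []. Qed.

Lemma inA_comp F H G (b : hom (act H X) (act G X)) (a : hom (act F X) (act H X)) :
  inA (b \oc a) = inA b \oc inA a.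
Proof. by rewrite /inA /= end_mulE. Qed.

Lemma inB_comp F H G (b : hom (act H Y) (act G Y)) (a : hom (act F Y) (act H Y)) :
  inB (b \oc a) = inB b \oc inB a.
Proof. by rewrite /inB /= end_mulE. Qed.

Lemma outA_comp F H G (b : @hom _ L (inl H) (inl G)) (a : @hom _ L (inl F) (inl H)) :
  outA (b \oc a) = outA b \oc outA a.
Proof. by rewrite /outA /= end_mulE. Qed.

Lemma outB_comp F H G (b : @hom _ L (inr H) (inr G)) (a : @hom _ L (inr F) (inr H)) :
  outB (b \oc a) = outB b \oc outB a.
Proof. by rewrite /outB /= end_mulE. Qed.

Lemma inA_id F : inA (idm (act F X)) = idm (inl F : L).
Proof. by rewrite /inA /= end_oneE. Qed.

Lemma inB_id F : inB (idm (act F Y)) = idm (inr F : L).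
Proof. by rewrite /inB /= end_oneE. Qed.

Lemma inA_sum F G I (r : seq I) (a : I -> hom (act F X) (act G X)) :
  inA (\sum_(i <- r) a i) = \sum_(i <- r) inA (a i).
Proof. by []. Qed.

Lemma outB_sum F G I (r : seq I) (b : I -> @hom _ L (inr F) (inr G)) :
  outB (\sum_(i <- r) b i) = \sum_(i <- r) outB (b i).
Proof. by []. Qed.

Lemma inA_str K F G (a : hom (act F X) (act G X)) :
  link_str K (inA a) = inA (act_conj K a).
Proof. by []. Qed.

Lemma inB_str K F G (b : hom (act F Y) (act G Y)) :
  link_str K (inB b) = inB (act_conj K b).
Proof. by []. Qed.

(** By unitality, the morphisms of C act on a bimodule through the units of the
    two monoids; this turns the Tambara axioms into equations in the linking category. *)
Lemma link_tmapQ F F' G G' (f : hom F' F) (g : hom G G')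
    (q : @hom _ L (inr F) (inl G)) :
  tmap (ctxQ c) f g q = inA (actm X g) \oc q \oc inB (actm Y f)
    :> @hom _ L (inr F') (inl G').
Proof. exact: tmap_act. Qed.

Lemma link_str_extranat K K' F G (h : hom K K') (q : @hom _ L (inr F) (inl G)) :
  inA (actm X (h \otm idm G)) \oc link_str K q =
  link_str K' q \oc inB (actm Y (h \otm idm F)).
Proof.
have := tstr_extranat (t := ctxQ c) h q.
rewrite !link_tmapQ !actm_id inA_id inB_id.
by rewrite [X in X = _]compm1 -[X in _ = X]compA [X in _ = X]comp1m.
Qed.

Lemma link_str_assoc K H F G (q : @hom _ L (inr F) (inl G)) :
  link_str (K \ot H) q =
  inA (actm X (bwd (assoc K H G))) \oc link_str K (link_str H q)
    \oc inB (actm Y (fwd (assoc K H F))).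
Proof. by rewrite -link_tmapQ; exact: tstr_assoc. Qed.

Lemma link_str_unit F G (q : @hom _ L (inr F) (inl G)) :
  link_str one q =
  inA (actm X (bwd (lunit G))) \oc q \oc inB (actm Y (fwd (lunit F))).
Proof. by rewrite -link_tmapQ; exact: tstr_unit. Qed.

End Embeddings.

(** * Realizations *)

Section Realization.

Variables (k : fieldType) (C : moncat k) (M N : modcat C) (X : M) (Y : N).
Variable c : morita_context (end_monoid X) (end_monoid Y).

Local Notation L := (link c).
Local Notation homP F G := (@hom _ L (inl F) (inr G)).
Local Notation homQ G F := (@hom _ L (inr G) (inl F)).
Local Notation inA := (@inA _ _ _ _ _ _ c _ _).
Local Notation outA := (@outA _ _ _ _ _ _ c _ _).
Local Notation inB := (@inB _ _ _ _ _ _ c _ _).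
Local Notation outB := (@outB _ _ _ _ _ _ c _ _).

Definition detour (F : C) : Type := tens (ctxP c) (ctxQ c) F F.
Definition dt_ob F (t : detour F) : C := projT1 t.
Definition dt_x F (t : detour F) : homP F (dt_ob t) := (projT2 t).1.
Definition dt_y F (t : detour F) : homQ (dt_ob t) F := (projT2 t).2.

Local Notation framed := (frame X detour).
Local Notation fG s := (dt_ob (fr_t s)).
Local Notation fx s := (dt_x (fr_t s)).
Local Notation fy s := (dt_y (fr_t s)).

Definition is_frame Z (r : seq (framed Z)) : Prop :=
  \sum_(s <- r) fr_p s \oc outA (fy s \oc fx s) \oc fr_i s = idm Z.

(** As f is the sum of the p_s y_s x_s i_s f, additivity in f and the possibility
    of moving endomorphisms of the orbit of X from f to q give the formula. *)
Lemma frame_absorb Z (r : seq (framed Z)) : is_frame r ->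
  forall G (V : lmodType k) (t : forall F, hom (act F X) Z -> homQ G F -> V),
  (forall F q, linear (fun f => t F f q)) ->
  (forall F F' f (a : hom (act F X) (act F' X)) q,
     t F' f (inA a \oc q) = t F (f \oc a) q) ->
  forall F f q,
  \sum_(s <- r) t _ (fr_p s) (fy s \oc (fx s \oc inA (fr_i s \oc f) \oc q)) =
  t F f q.
Proof.
move=> rE G V t t_lin t_bal F f q.
rewrite -[f in RHS]comp1m -rE comp_suml (lin_sum (t_lin F q)).
apply: eq_bigr => s _.
rewrite -!compA (compA (fy s)) -[fy s \oc fx s]outAK compA -inA_comp t_bal.
by rewrite !compA.
Qed.

(** W realizes Z when it is what Z becomes in N under the context.  If M, N and
    the linking category were parts of one ambient category, W would be isomorphic
    to Z there, and [rz_in f q] and [rz_out x g] would be the composites f q and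
    x g transported along the isomorphism.  These maps determine W, and the laws
    that they satisfy mention only M, N and the linking category. *)
Record realization (Z : M) : Type := Realization {
  rz_ob :> N;
  rz_in : forall F G, hom (act F X) Z -> homQ G F -> hom (act G Y) rz_ob;
  rz_out : forall F G, homP F G -> hom Z (act F X) -> hom rz_ob (act G Y);
  rz_seq : seq (framed Z);
  rz_frame : is_frame rz_seq;
  rz_in_lin : forall F G (q : homQ G F), linear (fun f => rz_in f q);
  rz_in_l : forall F F' G f (a : hom (act F X) (act F' X)) (q : homQ G F),
    rz_in f (inA a \oc q) = rz_in (f \oc a) q;
  rz_in_r : forall F G G' f (q : homQ G F) (b : hom (act G' Y) (act G Y)),
    rz_in f (q \oc inB b) = rz_in f q \oc b;
  rz_pair : forall F F' G G' (x : homP F' G') g f (q : homQ G F),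
    rz_out x g \oc rz_in f q = outB (x \oc inA (g \oc f) \oc q);
  rz_id :
    \sum_(s <- rz_seq) rz_in (fr_p s) (fy s) \oc rz_out (fx s) (fr_i s) =
    idm rz_ob
}.

Section Existence.

Variables (Z : M) (r : seq (framed Z)).
Hypothesis rE : is_frame r.

Let n := size r.
Let s_ (j : 'I_n) : framed Z := tnth (in_tuple r) j.

Variables (S : N).
Variables (inj : forall j : 'I_n, hom (act (fG (s_ j)) Y) S).
Variables (prj : forall j : 'I_n, hom S (act (fG (s_ j)) Y)).
Hypothesis prj_inj : forall j, prj j \oc inj j = idm _.
Hypothesis prj_inj0 : forall j l, j != l -> prj j \oc inj l = 0.

Let rE' :
  \sum_j fr_p (s_ j) \oc outA (fy (s_ j) \oc fx (s_ j)) \oc fr_i (s_ j) = idm Z.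
Proof. by rewrite -rE [RHS]big_tnth. Qed.

Lemma sum_prj_inj (V W : N) (u : forall j, hom (act (fG (s_ j)) Y) V)
    (v : forall j, hom W (act (fG (s_ j)) Y)) :
  (\sum_j u j \oc prj j) \oc (\sum_j inj j \oc v j) = \sum_j u j \oc v j.
Proof.
rewrite comp_suml; apply: eq_bigr => j _.
rewrite comp_sumr (bigD1 j) //= big1 ?addr0.
  by rewrite -compA (compA (prj j)) prj_inj comp1m.
move=> l lj; rewrite -compA (compA (prj j)) prj_inj0 1?eq_sym //.
by rewrite (lin0 (comp_linl _)) (lin0 (comp_linr _)).
Qed.

(** S is the direct sum of the objects G_j Y over the frame.  In an ambient
    category that contains M, N and the linking category, Z is the retract of S
    given by the maps x_j i_j from Z and p_j y_j to Z; [pre_in], [pre_out] and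
    [pre_idem] are the composites of these with f q, with x g and with each
    other. *)
Definition pre_in F G (f : hom (act F X) Z) (q : homQ G F) : hom (act G Y) S :=
  \sum_j inj j \oc outB (fx (s_ j) \oc inA (fr_i (s_ j) \oc f) \oc q).

Definition pre_out F G (x : homP F G) (g : hom Z (act F X)) : hom S (act G Y) :=
  \sum_j outB (x \oc inA (g \oc fr_p (s_ j)) \oc fy (s_ j)) \oc prj j.

Definition pre_idem : hom S S :=
  \sum_j inj j \oc pre_out (fx (s_ j)) (fr_i (s_ j)).

Lemma pre_pair F F' G G' (x : homP F' G') g f (q : homQ G F) :
  pre_out x g \oc pre_in f q = outB (x \oc inA (g \oc f) \oc q).
Proof.
rewrite /pre_out /pre_in sum_prj_inj.
rewrite -[g in RHS]compm1 -rE' comp_sumr comp_suml inA_sum comp_sumr comp_suml.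
rewrite outB_sum; apply: eq_bigr => j _.
set o := outA _.
have -> : g \oc (fr_p (s_ j) \oc o \oc fr_i (s_ j)) \oc f =
    (g \oc fr_p (s_ j)) \oc o \oc (fr_i (s_ j) \oc f) by rewrite !compA.
by rewrite -outB_comp !inA_comp outAK !compA.
Qed.

Lemma pre_idemE :
  pre_idem = \sum_j pre_in (fr_p (s_ j)) (fy (s_ j)) \oc prj j.
Proof.
rewrite /pre_idem /pre_out /pre_in.
under eq_bigr => j _ do rewrite comp_sumr.
under [RHS]eq_bigr => j _ do rewrite comp_suml.
by rewrite exchange_big; apply: eq_bigr => j _; apply: eq_bigr => l _; rewrite compA.
Qed.

Lemma pre_idem_in F G f (q : homQ G F) : pre_idem \oc pre_in f q = pre_in f q.
Proof.
rewrite [in LHS]/pre_idem comp_suml; apply: eq_bigr => j _.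
by rewrite -compA pre_pair.
Qed.

Lemma pre_idemM : pre_idem \oc pre_idem = pre_idem.
Proof.
rewrite {2 3}pre_idemE comp_sumr; apply: eq_bigr => j _.
by rewrite compA pre_idem_in.
Qed.

Lemma pre_id :
  \sum_j pre_in (fr_p (s_ j)) (fy (s_ j)) \oc pre_out (fx (s_ j)) (fr_i (s_ j))
  = pre_idem.
Proof. by rewrite -[RHS]pre_idemM {1}pre_idemE sum_prj_inj. Qed.

Lemma pre_in_lin F G (q : homQ G F) :
  linear (fun f : hom (act F X) Z => pre_in f q).
Proof.
move=> a f f'; rewrite /pre_in scaler_sumr -big_split; apply: eq_bigr => j _.
rewrite comp_linr.
have -> : inA (a *: (fr_i (s_ j) \oc f) + fr_i (s_ j) \oc f') =
  a *: inA (fr_i (s_ j) \oc f) + inA (fr_i (s_ j) \oc f') by [].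
rewrite comp_linr comp_linl.
exact: (comp_linr (inj j) a (outB _) (outB _)).
Qed.

Variables (W : N) (i : hom W S) (p : hom S W).
Hypothesis pi : p \oc i = idm W.
Hypothesis ip : i \oc p = pre_idem.

Program Definition split_realization : realization Z :=
  @Realization Z W (fun F G f q => p \oc pre_in f q)
    (fun F G x g => pre_out x g \oc i) r rE _ _ _ _ _.
Next Obligation. by move=> F G q a f f'; rewrite pre_in_lin comp_linr. Qed.
Next Obligation.
move=> F F' G f a q; congr (p \oc _); apply: eq_bigr => j _.
by rewrite (compA (fr_i _)) inA_comp !compA.
Qed.
Next Obligation.
move=> F G G' f q b; rewrite -compA; congr (p \oc _).
rewrite /pre_in comp_suml; apply: eq_bigr => j _.
by rewrite compA outB_comp inBK !compA.
Qed.
Next Obligation.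
move=> F F' G G' x g f q /=.
by rewrite -compA (compA i) ip pre_idem_in pre_pair.
Qed.
Next Obligation.
rewrite (big_tnth _ _ r) /=.
transitivity (p \oc pre_idem \oc i).
  rewrite -pre_id comp_sumr comp_suml; apply: eq_bigr => j _.
  by rewrite !compA.
by rewrite -ip compA pi comp1m pi.
Qed.

End Existence.

Hypothesis X_gen : is_cyclic_generator X.
Hypothesis N_cauchy : cauchy_complete N.

Lemma frame_exists Z : exists r : seq (framed Z), is_frame r.
Proof.
apply: (generator_frames (w := fun F (t : detour F) => outA (dt_y t \oc dt_x t)))
  => // F.
have [r rE] := ctx_mu_onto c F; exists r.
by rewrite -[RHS]end_oneE -rE.
Qed.

Lemma realization_exists Z : inhabited (realization Z).
Proof.
have [N_add N_split] := N_cauchy.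
have [r rE] := frame_exists Z.
have [S [inj [prj [prj_inj prj_inj0 _]]]] :=
  N_add _ (fun j => act (fG (tnth (in_tuple r) j)) Y).
have [W [i [p [pi ip]]]] := N_split _ _ (pre_idemM rE prj_inj prj_inj0).
by constructor; exact: (split_realization rE prj_inj prj_inj0 pi ip).
Qed.

End Realization.

(** * The module functor given by realizations *)

Section RealizationFunctor.

Variables (k : fieldType) (C : moncat k) (M N : modcat C) (X : M) (Y : N).
Variable c : morita_context (end_monoid X) (end_monoid Y).

Local Notation L := (link c).
Local Notation homQ G F := (@hom _ L (inr G) (inl F)).
Local Notation inA := (@inA _ _ _ _ _ _ c _ _).
Local Notation outA := (@outA _ _ _ _ _ _ c _ _).
Local Notation inB := (@inB _ _ _ _ _ _ c _ _).
Local Notation outB := (@outB _ _ _ _ _ _ c _ _).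
Local Notation fx s := (dt_x (fr_t s)).
Local Notation fy s := (dt_y (fr_t s)).

Section Extension.

Variables (Z : M) (W : realization c Z).

Lemma rz_ext (D : lincat k) (T : functor N D) (V : D) (u v : hom (T W) V) :
  (forall F G f (q : homQ G F),
     u \oc fmap T (rz_in W f q) = v \oc fmap T (rz_in W f q)) ->
  u = v.
Proof.
move=> uv; rewrite -[u]compm1 -[v]compm1 -fmap_id -(rz_id W) linear_sum.
rewrite !comp_sumr; apply: eq_bigr => s _.
by rewrite fmap_comp !compA uv.
Qed.

(** The formula that a map out of W must satisfy if its composites with the
    [rz_in f q] are the [t f q]. *)
Definition rz_desc (D : lincat k) (T : functor N D) (V : D)
    (t : forall F G, hom (act F X) Z -> homQ G F -> hom (T (act G Y)) V) :
    hom (T W) V :=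
  \sum_(s <- rz_seq W)
    t _ _ (fr_p s) (fy s) \oc fmap T (rz_out W (fx s) (fr_i s)).

(** W is a weighted colimit of the orbit of Y with cocone [rz_in], and, being cut
    out of a finite direct sum by an idempotent, it is preserved by every linear
    functor T.  The case of the identity defines the functor on morphisms, and
    that of the action of an object of C its compatibility with this action. *)
Lemma rz_descE (D : lincat k) (T : functor N D) (V : D)
    (t : forall F G, hom (act F X) Z -> homQ G F -> hom (T (act G Y)) V) :
  (forall F G (q : homQ G F), linear (fun f => t F G f q)) ->
  (forall F F' G f (a : hom (act F X) (act F' X)) (q : homQ G F),
     t F' G f (inA a \oc q) = t F G (f \oc a) q) ->
  (forall F G G' f (q : homQ G F) (b : hom (act G' Y) (act G Y)),
     t F G' f (q \oc inB b) = t F G f q \oc fmap T b) ->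
  forall F G f (q : homQ G F),
    rz_desc t \oc fmap T (rz_in W f q) = t F G f q.
Proof.
move=> t_lin t_l t_r F G f q.
rewrite -(frame_absorb (rz_frame W) (fun F' => t_lin F' G)
  (fun F1 F2 => t_l F1 F2 G)) comp_suml.
apply: eq_bigr => s _.
by rewrite -compA -fmap_comp rz_pair -t_r outBK.
Qed.

End Extension.

Variable R : forall Z : M, realization c Z.

Definition rf_map (Z Z' : M) (h : hom Z Z') : hom (R Z) (R Z') :=
  @rz_desc Z (R Z) N (id_functor N) (R Z')
    (fun F G f q => rz_in (R Z') (h \oc f) q).

Lemma rf_mapE Z Z' (h : hom Z Z') F G f (q : homQ G F) :
  rf_map h \oc rz_in (R Z) f q = rz_in (R Z') (h \oc f) q.
Proof.
apply: (rz_descE (R Z) (T := id_functor N)) => [F' G' q' a f1 f2|*|*] /=.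
- by rewrite comp_linr rz_in_lin.
- by rewrite rz_in_l compA.
- by rewrite rz_in_r.
Qed.

Lemma rf_ext Z (V : N) (u v : hom (R Z) V) :
  (forall F G f (q : homQ G F), u \oc rz_in (R Z) f q = v \oc rz_in (R Z) f q) ->
  u = v.
Proof. exact: (@rz_ext Z (R Z) N (id_functor N)). Qed.

Lemma rf_map_linear Z Z' : linear (@rf_map Z Z').
Proof.
move=> a h h'; apply: rf_ext => F G f q.
by rewrite rf_mapE !comp_linl rz_in_lin !rf_mapE.
Qed.

Lemma rf_map_id Z : mklinear (@rf_map_linear Z Z) (idm Z) = idm (R Z : N).
Proof. by apply: rf_ext => F G f q; rewrite rf_mapE !comp1m. Qed.

Lemma rf_map_comp Z Z' Z'' (h' : hom Z' Z'') (h : hom Z Z') :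
  mklinear (@rf_map_linear Z Z'') (h' \oc h) =
  mklinear (@rf_map_linear Z' Z'') h' \oc mklinear (@rf_map_linear Z Z') h.
Proof. by apply: rf_ext => F G f q; rewrite -compA !rf_mapE !compA. Qed.

Definition rf_functor : functor M N :=
  @Functor _ M N (fun Z => rz_ob (R Z)) (fun Z Z' => mklinear (@rf_map_linear Z Z'))
    rf_map_id rf_map_comp.

Lemma rf_functorE Z Z' (h : hom Z Z') F G f (q : homQ G F) :
  fmap rf_functor h \oc rz_in (R Z) f q = rz_in (R Z') (h \oc f) q.
Proof. exact: rf_mapE. Qed.

Section ModuleStructure.

Variables (K : C) (Z : M).

Local Notation KZ := (act K Z).

(** The isomorphism from K E(Z) to E(K Z) is determined by its composites with the
    images under K of the cocone of E(Z). *)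
Definition rf_str_leg F G (f : hom (act F X) Z) (q : homQ G F) :
    hom (act K (act G Y)) (R KZ) :=
  rz_in (R KZ) (fmap (act K) f \oc bwd (mten K F X)) (link_str K q)
    \oc fwd (mten K G Y).

Definition rf_str : hom (act K (R Z)) (R KZ) :=
  @rz_desc Z (R Z) N (act K) (R KZ) rf_str_leg.

Lemma rf_strE F G f (q : homQ G F) :
  rf_str \oc fmap (act K) (rz_in (R Z) f q) = rf_str_leg f q.
Proof.
apply: (rz_descE (R Z)) => [F' G' q' a f1 f2|F1 F2 G' f' a q'|F' G1 G2 f' q' b].
- by rewrite /rf_str_leg linearP comp_linl rz_in_lin comp_linl.
- rewrite /rf_str_leg link_str_comp inA_str rz_in_l; congr (rz_in _ _ _ \oc _).
  by rewrite fmap_comp /act_conj -!compA comp_bwdK.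
- rewrite /rf_str_leg link_str_comp inB_str rz_in_r.
  by rewrite -[LHS]compA -[RHS]compA act_conjE.
Qed.

Definition rf_str_inv : hom (R KZ) (act K (R Z)) :=
  \sum_(s <- rz_seq (R Z))
    fmap (act K) (rz_in (R Z) (fr_p s) (fy s)) \oc bwd (mten K _ Y)
      \oc rz_out (R KZ) (link_str K (fx s))
            (fwd (mten K _ X) \oc fmap (act K) (fr_i s)).

Lemma rf_str_invK : rf_str_inv \oc rf_str = idm _.
Proof.
apply: (@rz_ext Z (R Z) N (act K)) => F G f q.
rewrite -compA rf_strE comp1m.
have E := frame_absorb (rz_frame (R Z)) (G := G)
  (t := fun F f q => fmap (act K) (rz_in (R Z) f q)).
rewrite -E => [|F' q' a f1 f2|F1 F2 f' a q']; first last.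
- by rewrite rz_in_l.
- by rewrite rz_in_lin linearP.
rewrite comp_suml; apply: eq_bigr => s _.
rewrite /rf_str_leg -compA (compA (rz_out _ _ _)) rz_pair.
rewrite -[fx s \oc _ \oc q]outBK rz_in_r fmap_comp -compA; congr (_ \oc _).
rewrite -(compA (fwd (mten K _ X))) (compA (fmap _ (fr_i s))) -fmap_comp.
set a := fr_i s \oc f.
have -> : inA (fwd (mten K _ X) \oc (fmap (act K) a \oc bwd (mten K F X))) =
    link_str K (inA a) by rewrite compA inA_str.
have -> : outB (link_str K (fx s) \oc link_str K (inA a) \oc link_str K q) =
    act_conj K (outB (fx s \oc inA a \oc q)).
  by rewrite -[RHS]/(outB (link_str K (fx s \oc inA a \oc q))) !link_str_comp.
by rewrite act_conjE comp_bwdK.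
Qed.

Lemma rf_strK : rf_str \oc rf_str_inv = idm _.
Proof.
apply: rf_ext => F G f q; rewrite comp1m -compA.
rewrite [rf_str_inv \oc _]comp_suml comp_sumr.
transitivity (\sum_(s <- rz_seq (R Z))
  rz_in (R KZ) (fmap (act K) (fr_p s \oc outA (fy s \oc fx s) \oc fr_i s)
    \oc f) q).
  apply: eq_bigr => s _.
  rewrite -!compA rz_pair (compA rf_str) rf_strE /rf_str_leg.
  rewrite -compA comp_fwdK -rz_in_r outBK.
  set o := outA _; set g := fwd _ \oc _ \oc f.
  have -> : link_str K (fy s) \oc (link_str K (fx s) \oc inA g \oc q) =
      inA (act_conj K o \oc g) \oc q.
    by rewrite inA_comp -inA_str outAK link_str_comp !compA.
  rewrite rz_in_l; congr (rz_in _ _ q).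
  rewrite /act_conj /g !fmap_comp -!compA.
  by rewrite comp_bwdK comp_bwdK.
rewrite -(lin_sum (@rz_in_lin _ _ _ _ _ _ _ _ (R KZ) F G q)) -comp_suml.
by rewrite -linear_sum (rz_frame (R Z)) fmap_id comp1m.
Qed.

Definition rf_iso : iso (act K (rf_functor Z)) (rf_functor KZ) :=
  Iso rf_str_invK rf_strK.

Lemma rf_isoE F G f (q : homQ G F) :
  fwd rf_iso \oc fmap (act K) (rz_in (R Z) f q) =
  rz_in (R KZ) (fmap (act K) f \oc bwd (mten K F X)) (link_str K q)
    \oc fwd (mten K G Y).
Proof. exact: rf_strE. Qed.

End ModuleStructure.

End RealizationFunctor.

Section RealizationModuleFunctor.

Variables (k : fieldType) (C : moncat k) (M N : modcat C) (X : M) (Y : N).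
Variable c : morita_context (end_monoid X) (end_monoid Y).
Variable R : forall Z : M, realization c Z.

Local Notation L := (link c).
Local Notation homP F G := (@hom _ L (inl F) (inr G)).
Local Notation homQ G F := (@hom _ L (inr G) (inl F)).
Local Notation inA := (@inA _ _ _ _ _ _ c _ _).
Local Notation outA := (@outA _ _ _ _ _ _ c _ _).
Local Notation inB := (@inB _ _ _ _ _ _ c _ _).
Local Notation outB := (@outB _ _ _ _ _ _ c _ _).
Local Notation fx s := (dt_x (fr_t s)).
Local Notation fy s := (dt_y (fr_t s)).
Local Notation E := (rf_functor R).

Lemma rf_iso_nat K Z Z' (u : hom Z Z') :
  fwd (rf_iso R K Z') \oc fmap (act K) (fmap E u) =
  fmap E (fmap (act K) u) \oc fwd (rf_iso R K Z).
Proof.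
apply: (@rz_ext _ _ _ _ _ _ _ _ (R Z) N (act K)) => F G f q.
rewrite -!compA -fmap_comp rf_functorE !rf_isoE (compA (fmap E _)) rf_functorE.
by rewrite fmap_comp !compA.
Qed.

Lemma rf_iso_natm K K' (h : hom K K') Z :
  fwd (rf_iso R K' Z) \oc actm (E Z) h = fmap E (actm Z h) \oc fwd (rf_iso R K Z).
Proof.
apply: (@rz_ext _ _ _ _ _ _ _ _ (R Z) N (act K)) => F G f q.
rewrite -!compA rf_isoE (compA (fmap E _)) rf_functorE.
rewrite actm_nat (compA (fwd _)) rf_isoE.
rewrite -compA -mten_natl compA -rz_in_r -link_str_extranat rz_in_l.
congr (rz_in _ _ _ \oc _).
by rewrite -compA mten_natl_bwd !compA actm_nat.
Qed.

Lemma mten_assoc_fwd K H G (W : N) :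
  fwd (mten (K \ot H) G W) \oc fwd (mten K H (act G W)) =
  actm W (bwd (assoc K H G)) \oc fwd (mten K (H \ot G) W)
    \oc fmap (act K) (fwd (mten H G W)).
Proof.
rewrite -[RHS]compA mten_assoc !compA -actm_comp bwdK actm_id.
by rewrite comp1m.
Qed.

Lemma rf_iso_ten K H Z :
  fwd (rf_iso R (K \ot H) Z) \oc fwd (mten K H (E Z)) =
  fmap E (fwd (mten K H Z)) \oc fwd (rf_iso R K (act H Z))
    \oc fmap (act K) (fwd (rf_iso R H Z)).
Proof.
apply: (@rz_ext _ _ _ _ _ _ _ _ (R Z) N (comp_functor (act K) (act H))).
move=> F G f q /=.
rewrite -!compA -fmap_comp rf_isoE.
rewrite fmap_comp (compA (fwd (rf_iso R K _))) rf_isoE.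
rewrite !compA rf_functorE.
rewrite -[_ \oc fwd (mten K H _) \oc _]compA mten_nat compA rf_isoE.
rewrite -[LHS]compA mten_assoc_fwd !compA; congr (_ \oc _ \oc _).
rewrite -rz_in_r link_str_assoc -!compA -inB_comp.
rewrite -actm_comp fwdK actm_id inB_id compm1 rz_in_l; congr (rz_in _ _ _).
have Em : fmap (act K) (bwd (mten H F X)) \oc bwd (mten K (H \ot F) X) =
    bwd (mten K H (act F X)) \oc bwd (mten (K \ot H) F X)
      \oc actm X (bwd (assoc K H F)).
  by rewrite -mten_assoc_bwd -!compA -actm_comp fwdK actm_id compm1.
rewrite fmap_comp -!compA Em !compA mten_nat.
by rewrite -[_ \oc fwd _ \oc bwd _]compA fwdK compm1.
Qed.

Lemma rf_iso_one Z :
  fwd (rf_iso R one Z) \oc fwd (mone (E Z)) = fmap E (fwd (mone Z)).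
Proof.
apply: rf_ext => F G f q.
rewrite rf_functorE -compA (mone_nat (rz_in (R Z) f q)) compA rf_isoE -compA.
have mE (W : N) : fwd (mten one G W) \oc fwd (mone (act G W)) =
    actm W (bwd (lunit G)).
  rewrite -[LHS]comp1m -actm_id -(bwdK (lunit G)) actm_comp -[LHS]compA.
  by rewrite [X in _ \oc X]compA mten_lunit compm1.
rewrite mE -rz_in_r link_str_unit -!compA -inB_comp -actm_comp fwdK actm_id.
rewrite inB_id compm1 rz_in_l; congr (rz_in _ _ _).
rewrite mone_act -!compA -actm_comp fwdK actm_id compm1.
by rewrite mone_nat.
Qed.

Definition rf_modfunctor : modfunctor M N :=
  @ModFunctor _ _ M N E (rf_iso R) rf_iso_nat rf_iso_natm rf_iso_ten rf_iso_one.

(** A morphism of M is recovered from its coefficients, which are morphisms of the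
    linking category between objects of the copy that corresponds to N. *)
Lemma rf_frame_expand Z Z' (r : seq (frame X (detour c) Z))
    (r' : seq (frame X (detour c) Z')) (h : hom Z Z') :
  is_frame r -> is_frame r' ->
  h = \sum_(t <- r') \sum_(s <- r) fr_p t \oc
        outA (fy t \oc (fx t \oc inA (fr_i t \oc h \oc fr_p s) \oc fy s) \oc fx s)
        \oc fr_i s.
Proof.
move=> rE r'E; rewrite -[LHS]comp1m -r'E comp_suml; apply: eq_bigr => t _.
rewrite -[h in LHS]compm1 -rE !comp_sumr; apply: eq_bigr => s _.
set o := outA _; set o' := outA _; set a := fr_i t \oc h \oc fr_p s.
have -> : outA (fy t \oc (fx t \oc inA a \oc fy s) \oc fx s) = o \oc a \oc o'.
  by rewrite -[a in RHS](inAK c) -!outA_comp !compA.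
by rewrite /a !compA.
Qed.

Lemma rf_faithful Z Z' : injective (@fmap _ _ _ E Z Z').
Proof.
move=> h h' hh'.
rewrite (rf_frame_expand h (rz_frame (R Z)) (rz_frame (R Z'))).
rewrite (rf_frame_expand h' (rz_frame (R Z)) (rz_frame (R Z'))).
apply: eq_bigr => t _; apply: eq_bigr => s _.
suff -> : fx t \oc inA (fr_i t \oc h \oc fr_p s) \oc fy s =
  fx t \oc inA (fr_i t \oc h' \oc fr_p s) \oc fy s by [].
rewrite -[LHS]outBK -[RHS]outBK -!(compA (fr_i t)) -!(rz_pair (R Z')).
by rewrite -!rf_functorE hh'.
Qed.

(** The coefficients of u with respect to the frames of Z and Z' are those of the
    required preimage. *)
Lemma rf_full Z Z' (u : hom (E Z) (E Z')) : exists h, fmap E h = u.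
Proof.
pose b t s := rz_out (R Z') (fx t) (fr_i t) \oc u \oc rz_in (R Z) (fr_p s) (fy s).
exists (\sum_(t <- rz_seq (R Z')) \sum_(s <- rz_seq (R Z))
  fr_p t \oc outA (fy t \oc inB (b t s) \oc fx s) \oc fr_i s).
apply: rf_ext => F G f q; rewrite rf_functorE.
transitivity (\sum_(t <- rz_seq (R Z')) \sum_(s <- rz_seq (R Z))
  rz_in (R Z') (fr_p t) (fy t) \oc rz_out (R Z') (fx t) (fr_i t) \oc
    (u \oc rz_in (R Z) (fr_p s) (fy s \oc (fx s \oc inA (fr_i s \oc f) \oc q)))).
  rewrite comp_suml (lin_sum (rz_in_lin (R Z') q)); apply: eq_bigr => t _.
  rewrite comp_suml (lin_sum (rz_in_lin (R Z') q)); apply: eq_bigr => s _.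
  rewrite -(compA (fr_p t)) -(compA (fr_p t)) -rz_in_l.
  rewrite -(compA (outA _)) inA_comp outAK.
  set w := fx s \oc _ \oc _.
  have -> : fy t \oc inB (b t s) \oc fx s \oc inA (fr_i s \oc f) \oc q =
      fy t \oc inB (b t s \oc outB w).
    by rewrite inB_comp outBK /w !compA.
  by rewrite rz_in_r -[w in RHS]outBK rz_in_r /b !compA.
rewrite exchange_big /=.
under eq_bigr => s _ do rewrite -comp_suml rz_id comp1m.
rewrite -comp_sumr; congr (_ \oc _).
exact: (frame_absorb (rz_frame (R Z)) (t := fun F f q => rz_in (R Z) f q)
  (fun F q => rz_in_lin (R Z) q)
  (fun F F' f a q => rz_in_l (R Z) f a q)).
Qed.

Hypothesis M_cauchy : cauchy_complete M.
Hypothesis Y_gen : is_cyclic_generator Y.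

(** An expansion of the identity of V through the orbit of Y, each of whose
    objects is itself expanded through the orbit of X, makes V a retract of the
    image of a direct sum of objects of the orbit of X. *)
Lemma rf_retract (V : N) : exists Z, is_direct_summand V (E Z).
Proof.
pose wB G (t : tens (ctxQ c) (ctxP c) G G) : hom (act G Y) (act G Y) :=
  outB (((projT2 t).2 : homP (projT1 t) G) \oc ((projT2 t).1 : homQ G (projT1 t))).
have wB1 G : exists r, \sum_(t <- r) wB G t = idm (act G Y).
  have [r rE] := ctx_nu_onto c G; exists r.
  by rewrite -[RHS]end_oneE -rE.
have [r rE] := generator_frames Y_gen wB1 V.
pose s_ j := tnth (in_tuple r) j.
pose xo j := projT1 (fr_t (s_ j)).
have [M_add _] := M_cauchy.
have [S [inj [prj [prj_inj prj_inj0 _]]]] := M_add _ (fun j => act (xo j) X).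
pose yy j : homQ (fr_ob (s_ j)) (xo j) := (projT2 (fr_t (s_ j))).1.
pose xx j : homP (xo j) (fr_ob (s_ j)) := (projT2 (fr_t (s_ j))).2.
exists S, (\sum_j rz_in (R S) (inj j) (yy j) \oc fr_i (s_ j)),
  (\sum_j fr_p (s_ j) \oc rz_out (R S) (xx j) (prj j)).
rewrite -rE [RHS]big_tnth comp_suml; apply: eq_bigr => j _.
rewrite comp_sumr (bigD1 j) //= big1 ?addr0.
  rewrite -compA (compA (rz_out _ _ _)) rz_pair prj_inj inA_id compm1.
  by rewrite compA.
move=> l lj; rewrite -compA (compA (rz_out _ _ _)) rz_pair.
rewrite prj_inj0 1?eq_sym //.
have -> : inA (0 : hom (act (xo l) X) (act (xo j) X)) = 0 by [].
rewrite (lin0 (comp_linr _)) (lin0 (comp_linl _)).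
have -> : outB (0 : @hom _ L (inr (fr_ob (s_ l))) (inr (fr_ob (s_ j)))) = 0 by [].
by rewrite (lin0 (comp_linl _)) (lin0 (comp_linr _)).
Qed.

Lemma rf_equivalence : is_equivalence rf_modfunctor.
Proof.
have [_ M_split] := M_cauchy.
exact: (ff_retract_equivalence rf_faithful rf_full M_split rf_retract).
Qed.

End RealizationModuleFunctor.

Lemma context_modcat_equivalent (k : fieldType) (C : moncat k)
    (M N : modcat C) (X : M) (Y : N) :
  cauchy_complete M -> cauchy_complete N ->
  is_cyclic_generator X -> is_cyclic_generator Y ->
  morita_context (end_monoid X) (end_monoid Y) -> modcat_equivalent M N.
Proof.
move=> M_cauchy N_cauchy X_gen Y_gen c.
have R Z : realization c Z.
  have [W _] := cid (let: inhabits W := realization_exists c X_gen N_cauchy Z in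
    ex_intro (fun _ => True) W I).
  exact: W.
by exists (rf_modfunctor R); exact: rf_equivalence.
Qed.

(** * Orbits in a module category and their Hom bimodules *)

Section Orbits.

Variables (k : fieldType) (C : moncat k) (N : modcat C).

(** A functor of C-module categories from C to N.  Every such functor is
    isomorphic to F |-> F Y for some Y, but working up to equality with the family
    Phi(F X) lets the endomorphism monoid of X act on it simply by Phi. *)
Record orbit : Type := Orbit {
  orb :> C -> N;
  orm : forall F G, {linear hom F G -> hom (orb F) (orb G)};
  orm_id : forall F, orm F F (idm F) = idm (orb F);
  orm_comp : forall F G H (g : hom G H) (f : hom F G),
    orm F H (g \oc f) = orm G H g \oc orm F G f;
  ors : forall K F, iso (act K (orb F)) (orb (K \ot F));
  ors_natr : forall K F G (f : hom F G),
    fwd (ors K G) \oc fmap (act K) (orm F G f) =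
    orm _ _ (idm K \otm f) \oc fwd (ors K F);
  ors_natl : forall K K' F (h : hom K K'),
    orm _ _ (h \otm idm F) \oc fwd (ors K F) =
    fwd (ors K' F) \oc actm (orb F) h;
  ors_assoc : forall K H F,
    fwd (ors K (H \ot F)) \oc fmap (act K) (fwd (ors H F)) =
    orm _ _ (fwd (assoc K H F)) \oc fwd (ors (K \ot H) F)
      \oc fwd (mten K H (orb F));
  ors_unit : forall F,
    orm _ _ (fwd (lunit F)) \oc fwd (ors one F) \oc fwd (mone (orb F)) =
    idm (orb F)
}.

End Orbits.

Arguments orm {k C N} _ {F G}.
Arguments ors {k C N} _ K F.

Section OrbitInstances.

Variables (k : fieldType) (C : moncat k).

Program Definition act_orbit (N : modcat C) (Y : N) : orbit N :=
  @Orbit k C N (fun F => act F Y) (fun F G => actm Y) _ _ (fun K F => mten K F Y)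
    _ _ _ _.
Next Obligation. by move=> *; rewrite actm_id. Qed.
Next Obligation. by move=> *; rewrite actm_comp. Qed.
Next Obligation. by move=> *; rewrite mten_natr. Qed.
Next Obligation. by move=> *; rewrite mten_natl. Qed.
Next Obligation. by move=> *; rewrite mten_assoc. Qed.
Next Obligation. by move=> *; rewrite mten_lunit. Qed.

Definition fmap_iso (D D' : lincat k) (T : functor D D') (a b : D) (i : iso a b) :
  iso (T a) (T b).
Proof.
by exists (fmap T (fwd i)) (fmap T (bwd i));
  rewrite -fmap_comp ?bwdK ?fwdK fmap_id.
Defined.

Definition comp_iso (D : lincat k) (a b d : D) (j : iso b d) (i : iso a b) :
  iso a d.
Proof.
exists (fwd j \oc fwd i) (bwd i \oc bwd j).
- by rewrite -compA comp_bwdK bwdK.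
- by rewrite -compA comp_fwdK fwdK.
Defined.

Variables (M N : modcat C) (Phi : modfunctor M N) (X : M).

Program Definition image_orbit : orbit N :=
  @Orbit k C N (fun F => Phi (act F X))
    (fun F G => mklinear (f := fun f : hom F G => fmap Phi (actm X f)) _) _ _
    (fun K F => comp_iso (fmap_iso Phi (mten K F X)) (mf_iso Phi K (act F X)))
    _ _ _ _.
Next Obligation. by move=> F G c f g; rewrite !linearP. Qed.
Next Obligation. by move=> F; rewrite /= actm_id fmap_id. Qed.
Next Obligation. by move=> F G H g f; rewrite /= actm_comp fmap_comp. Qed.
Next Obligation.
move=> K F G f /=.
by rewrite -compA mf_nat !compA -!fmap_comp mten_natr.
Qed.
Next Obligation.
move=> K K' F h /=.
by rewrite -[RHS]compA mf_natm !compA -!fmap_comp mten_natl.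
Qed.
Next Obligation.
move=> K H F /=.
rewrite fmap_comp -!compA (compA (fwd (mf_iso Phi K _))) mf_nat !compA.
rewrite -fmap_comp mten_assoc !fmap_comp -!compA; congr (_ \oc (_ \oc _)).
by rewrite mf_ten !compA.
Qed.
Next Obligation.
move=> F /=.
by rewrite -!compA mf_one -!fmap_comp !compA mten_lunit fmap_id.
Qed.

End OrbitInstances.

Section OrbitHom.

Variables (k : fieldType) (C : moncat k) (N : modcat C).

Lemma ors_natr_bwd (D : orbit N) K F G (f : hom F G) :
  fmap (act K) (orm D f) \oc bwd (ors D K F) =
  bwd (ors D K G) \oc orm D (idm K \otm f).
Proof.
rewrite -[LHS](comp_bwdK (ors D K G)); congr (_ \oc _).
by rewrite compA ors_natr -compA fwdK compm1.
Qed.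

Lemma ors_natl_bwd (D : orbit N) K K' F (h : hom K K') :
  bwd (ors D K' F) \oc orm D (h \otm idm F) =
  actm (D F) h \oc bwd (ors D K F).
Proof.
rewrite -[RHS](comp_bwdK (ors D K' F)); congr (_ \oc _).
by rewrite compA -ors_natl -compA fwdK compm1.
Qed.

Lemma ors_assoc_bwd (D : orbit N) K H F :
  fmap (act K) (bwd (ors D H F)) \oc bwd (ors D K (H \ot F))
    \oc orm D (fwd (assoc K H F)) =
  bwd (mten K H (D F)) \oc bwd (ors D (K \ot H) F).
Proof.
have cancel_r (a b d : N) (i : iso a b) (f g : hom b d) :
    f \oc fwd i = g \oc fwd i -> f = g.
  by move=> fg; rewrite -[f]compm1 -[g]compm1 -(fwdK i) !compA fg.
apply: (@cancel_r _ _ _ (ors D (K \ot H) F)).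
apply: (@cancel_r _ _ _ (mten K H (D F))).
rewrite -!compA (compA (orm D _)) -ors_assoc comp_bwdK -fmap_comp bwdK fmap_id.
by rewrite comp_bwdK bwdK.
Qed.

Lemma ors_unit_bwd (D : orbit N) F :
  bwd (ors D one F) = fwd (mone (D F)) \oc orm D (fwd (lunit F)).
Proof.
have aV : orm D (bwd (lunit F)) \oc orm D (fwd (lunit F)) = idm _.
  by rewrite -orm_comp bwdK orm_id.
have mE : fwd (ors D one F) \oc fwd (mone (D F)) = orm D (bwd (lunit F)).
  by rewrite -[LHS]comp1m -aV -compA [X in _ \oc X]compA ors_unit compm1.
by rewrite -[LHS]compm1 -aV -mE !compA bwdK comp1m.
Qed.

Variables (D D' : orbit N).

Lemma ohom_map_linear (F F' G G' : C) (f : hom F' F) (g : hom G G') :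
  linear (fun x : hom (D F) (D' G) => orm D' g \oc x \oc orm D f).
Proof. by move=> c x y; rewrite comp_linr comp_linl. Qed.

Lemma ohom_str_linear (K F G : C) :
  linear (fun x : hom (D F) (D' G) =>
    fwd (ors D' K G) \oc fmap (act K) x \oc bwd (ors D K F)).
Proof. by move=> c x y; rewrite linearP comp_linr comp_linl. Qed.

(** The internal endomorphism module of Y is the case D = D' = (F |-> F Y). *)
Program Definition ohom : tambara C := @Tambara k C
  (fun F G => hom (D F) (D' G))
  (fun F F' G G' f g => mklinear (ohom_map_linear f g)) _ _ _ _
  (fun K F G => mklinear (@ohom_str_linear K F G)) _ _ _ _.
Next Obligation.
by move=> F F' G G' g x c f f'; rewrite /= linearP comp_linr.
Qed.
Next Obligation.
by move=> F F' G G' f x c g g'; rewrite /= linearP !comp_linl.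
Qed.
Next Obligation. by move=> F G x; rewrite /= !orm_id comp1m compm1. Qed.
Next Obligation. by move=> *; rewrite /= !orm_comp !compA. Qed.
Next Obligation.
move=> K F F' G G' f g x; rewrite /= !fmap_comp !compA ors_natr -!compA.
by rewrite ors_natr_bwd.
Qed.
Next Obligation.
move=> K K' F G h x; rewrite /= !orm_id comp1m compm1 !compA ors_natl.
rewrite -[RHS]compA ors_natl_bwd !compA; congr (_ \oc _).
by rewrite -[LHS]compA actm_nat compA.
Qed.
Next Obligation.
move=> K H F G x; rewrite /= !fmap_comp.
have e : orm D' (bwd (assoc K H G)) \oc
    (fwd (ors D' K (H \ot G)) \oc fmap (act K) (fwd (ors D' H G))) =
    fwd (ors D' (K \ot H) G) \oc fwd (mten K H (D' G)).
  by rewrite ors_assoc !compA -orm_comp bwdK orm_id comp1m.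
transitivity (fwd (ors D' (K \ot H) G) \oc fwd (mten K H (D' G))
    \oc fmap (act K) (fmap (act H) x)
    \oc (bwd (mten K H (D F)) \oc bwd (ors D (K \ot H) F))).
  rewrite -[_ \oc _ \oc fmap (act K) _]compA mten_nat !compA.
  by rewrite -[_ \oc fwd _ \oc bwd _]compA fwdK compm1.
by rewrite -e -ors_assoc_bwd !compA.
Qed.
Next Obligation.
move=> F G x; rewrite /= ors_unit_bwd !compA; congr (_ \oc _).
rewrite -[_ \oc fmap _ _ \oc _]compA -mone_nat compA; congr (_ \oc _).
have aV : orm D' (bwd (lunit G)) \oc orm D' (fwd (lunit G)) = idm _.
  by rewrite -orm_comp bwdK orm_id.
by rewrite -[LHS]comp1m -aV -[LHS]compA [X in _ \oc X]compA ors_unit compm1.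
Qed.

End OrbitHom.

(** * Morita contexts from mutually generating orbits *)

Section Representations.

Variables (k : fieldType) (C : moncat k) (N : modcat C).

(** An isomorphism of monoids from A to the endomorphism monoid of an orbit. *)
Record rep (A : tmonoid C) (D : orbit N) : Type := Rep {
  rp : tmor A (ohom D D);
  rp_unit : forall F G (f : hom F G), tm rp (tm (munit A) f) = orm D f;
  rp_mul : forall F H G (a : A F H) (b : A H G),
    tm rp (a \*m b) = (tm rp b : hom (D H) (D G)) \oc tm rp a;
  rp_bij : forall F G, bijective (@tm _ _ _ _ rp F G)
}.

Definition generates (D D' : orbit N) : Prop :=
  forall F, exists r : seq {H : C & (hom (D F) (D' H) * hom (D' H) (D F))%type},
    \sum_(s <- r) (projT2 s).2 \oc (projT2 s).1 = idm (D F).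

Section HomBimodule.

Variables (A B : tmonoid C) (D D' : orbit N) (rho : rep A D) (sigma : rep B D').

Local Notation rA a := (tm (rp rho) a : hom (D _) (D _)).
Local Notation rB b := (tm (rp sigma) b : hom (D' _) (D' _)).
Local Notation P := (ohom D D').

Lemma rep_act_str (E1 E2 E3 : orbit N) K F H G (y : ohom E2 E3 H G)
    (x : ohom E1 E2 F H) :
  (tstr (ohom E2 E3) K y : hom (E2 _) (E3 _)) \oc tstr (ohom E1 E2) K x =
  tstr (ohom E1 E3) K ((y : hom (E2 _) (E3 _)) \oc (x : hom (E1 _) (E2 _)) :
    ohom E1 E3 F G).
Proof.
by rewrite /= fmap_comp -!compA comp_bwdK.
Qed.

Program Definition rep_lact : tmor (dia A P) P :=
  @dia_tmor k C A P P (fun F G H a x => x \oc rA a) _.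
Next Obligation.
split=> [F G|F F' G G' H f g a x|K F G H a x].
- split=> [H x e a a'|H a e x x'|H H' h a x] /=.
  + by rewrite linearP comp_linr.
  + by rewrite comp_linl.
  + by rewrite tm_nat /= !orm_id comp1m compm1 !compA.
- by rewrite tm_nat /= !orm_id compm1 comp1m !compA.
- by rewrite tm_str rep_act_str.
Qed.

Program Definition rep_ract : tmor (dia P B) P :=
  @dia_tmor k C P B P (fun F G H x b => rB b \oc x) _.
Next Obligation.
split=> [F G|F F' G G' H f g x b|K F G H x b].
- split=> [H b e x x'|H x e b b'|H H' h x b] /=.
  + by rewrite comp_linr.
  + by rewrite linearP comp_linl.
  + by rewrite tm_nat /= !orm_id comp1m compm1 !compA.
- by rewrite tm_nat /= !orm_id compm1 comp1m !compA.
- by rewrite tm_str rep_act_str.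
Qed.

Lemma rep_lactE F H G (a : A F H) (x : P H G) :
  tm rep_lact (a \dt x) = (x : hom (D H) (D' G)) \oc rA a.
Proof. exact: dia_tmorE. Qed.

Lemma rep_ractE F H G (x : P F H) (b : B H G) :
  tm rep_ract (x \dt b) = rB b \oc (x : hom (D F) (D' H)).
Proof. exact: dia_tmorE. Qed.

Program Definition rep_bimod : bimod A B :=
  @Bimod k C A B P rep_lact rep_ract _ _ _ _ _.
Next Obligation.
by move=> F H K G a a' x; rewrite !rep_lactE -compA -rp_mul.
Qed.
Next Obligation.
by move=> F H G f x; rewrite rep_lactE rp_unit /= orm_id comp1m.
Qed.
Next Obligation.
by move=> F H K G x b b'; rewrite !rep_ractE compA -rp_mul.
Qed.
Next Obligation.
by move=> F H G x g; rewrite rep_ractE rp_unit /= orm_id compm1.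
Qed.
Next Obligation.
by move=> F H K G a x b; rewrite !rep_lactE !rep_ractE compA.
Qed.

Lemma rep_lmulE F H G (a : A F H) (x : rep_bimod H G) :
  a \*l x = (x : hom (D H) (D' G)) \oc rA a :> hom (D F) (D' G).
Proof. exact: rep_lactE. Qed.

Lemma rep_rmulE F H G (x : rep_bimod F H) (b : B H G) :
  x \*r b = rB b \oc (x : hom (D F) (D' H)) :> hom (D F) (D' G).
Proof. exact: rep_ractE. Qed.

End HomBimodule.

Section HomPairing.

Variables (A B : tmonoid C) (D D' : orbit N) (rho : rep A D) (sigma : rep B D').

Local Notation P := (rep_bimod rho sigma).
Local Notation Q := (rep_bimod sigma rho).

(** Composition of morphisms D -> D' -> D, read in A through rho. *)
Lemma rep_pairing_exists :
  exists p : pairing P Q, forall F H G (x : P F H) (y : Q H G),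
    tm (rp rho) (pr p x y) = (y : hom (D' H) (D G)) \oc (x : hom (D F) (D' H)).
Proof.
have [v [vK Kv]] := tmor_inverse (rp_bij rho).
pose p F H G (x : P F H) (y : Q H G) : A F G :=
  tm v ((y : hom (D' H) (D G)) \oc (x : hom (D F) (D' H)) : ohom D D F G).
have pE F H G x y : tm (rp rho) (@p F H G x y) =
  (y : hom (D' H) (D G)) \oc (x : hom (D F) (D' H)) by exact: Kv.
have rp_inj F G (a b : A F G) : tm (rp rho) a = tm (rp rho) b -> a = b.
  exact: (bij_inj (rp_bij rho F G)).
have p_linl F H G (y : Q H G) : linear (fun x : P F H => p F H G x y).
  by move=> c x x'; rewrite /p comp_linr linearP.
have p_linr F H G (x : P F H) : linear (fun y : Q H G => p F H G x y).
  by move=> c y y'; rewrite /p comp_linl linearP.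
have p_bal F H K G (x : P F H) (b : B H K) (y : Q K G) :
    p _ _ _ (x \*r b) y = p _ _ _ x (b \*l y).
  by rewrite /p rep_rmulE rep_lmulE compA.
have p_lmul F H K G (a : A F H) (x : P H K) (y : Q K G) :
    p _ _ _ (a \*l x) y = a \*m p _ _ _ x y.
  by apply: rp_inj; rewrite rp_mul !pE rep_lmulE compA.
have p_rmul F H K G (x : P F H) (y : Q H K) (a : A K G) :
    p _ _ _ x (y \*r a) = p _ _ _ x y \*m a.
  by apply: rp_inj; rewrite rp_mul !pE rep_rmulE compA.
have p_str K F H G (x : P F H) (y : Q H G) :
    p _ _ _ (tstr P K x) (tstr Q K y) = tstr A K (p _ _ _ x y).
  by apply: rp_inj; rewrite tm_str !pE rep_act_str.
by exists (Pairing p_linl p_linr p_bal p_lmul p_rmul p_str).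
Qed.

Lemma rep_pairing_onto (p : pairing P Q) :
  (forall F H G (x : P F H) (y : Q H G),
    tm (rp rho) (pr p x y) = (y : hom (D' H) (D G)) \oc (x : hom (D F) (D' H))) ->
  generates D D' -> pr_onto p.
Proof.
move=> pE gen F; have [r rE] := gen F; exists r.
apply: (bij_inj (rp_bij rho F F)).
rewrite /mon_one rp_unit orm_id -rE linear_sum.
by apply: eq_bigr => s _; rewrite pE.
Qed.

End HomPairing.

Lemma context_of_orbits (A B : tmonoid C) (D D' : orbit N) :
  rep A D -> rep B D' -> generates D D' -> generates D' D ->
  inhabited (morita_context A B).
Proof.
move=> rho sigma gen gen'.
have [mu muE] := rep_pairing_exists rho sigma.
have [nu nuE] := rep_pairing_exists sigma rho.
constructor.
apply: (@MoritaContext _ _ A B (rep_bimod rho sigma) (rep_bimod sigma rho) mu nu).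
- exact: (rep_pairing_onto muE).
- exact: (rep_pairing_onto nuE).
- by move=> F H K G x y z; rewrite rep_lmulE rep_rmulE muE nuE compA.
- by move=> F H K G x y z; rewrite rep_lmulE rep_rmulE muE nuE compA.
Qed.

End Representations.

Section EquivalenceContext.

Variables (k : fieldType) (C : moncat k).

Program Definition act_rep (N : modcat C) (Y : N) :
    rep (end_monoid Y) (act_orbit Y) :=
  @Rep k C N (end_monoid Y) (act_orbit Y)
    (@TMor k C (iend Y) (ohom (act_orbit Y) (act_orbit Y))
      (fun F G => fmap (id_functor N)) _ _) _ _ _.
Next Obligation. by []. Qed.
Next Obligation. by []. Qed.
Next Obligation. by []. Qed.
Next Obligation. by move=> N Y F H G a b; rewrite end_mulE. Qed.
Next Obligation. by move=> N Y F G; exists id. Qed.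

Variables (M N : modcat C) (Phi : modfunctor M N) (X : M).
Hypothesis Phi_bij : forall a b : M, bijective (@fmap _ _ _ Phi a b).

Program Definition image_rep : rep (end_monoid X) (image_orbit Phi X) :=
  @Rep k C N (end_monoid X) (image_orbit Phi X)
    (@TMor k C (iend X) (ohom (image_orbit Phi X) (image_orbit Phi X))
      (fun F G => fmap Phi) _ _) _ _ _.
Next Obligation. by move=> F F' G G' f g x; rewrite /= !fmap_comp. Qed.
Next Obligation.
move=> K F G x; rewrite /= !fmap_comp !compA; congr (_ \oc _).
rewrite -[_ \oc fwd (mf_iso _ _ _) \oc _]compA mf_nat -!compA.
by rewrite fwdK compm1.
Qed.
Next Obligation. by []. Qed.
Next Obligation. by move=> F H G a b; rewrite end_mulE; exact: fmap_comp. Qed.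
Next Obligation. by move=> F G; exact: Phi_bij. Qed.

End EquivalenceContext.

Section EquivalenceFunctor.

Variables (k : fieldType) (D D' : lincat k) (E : functor D D').
Variables (G : functor D' D).
Variable unit_iso : natiso (comp_functor G E) (id_functor D).
Variable counit_iso : natiso (comp_functor E G) (id_functor D').

Lemma natiso_id_injective (D1 : lincat k) (T : functor D1 D1)
    (i : natiso T (id_functor D1)) a b : injective (@fmap _ _ _ T a b).
Proof.
move=> f g fg; have /= := niso_nat i f; rewrite fg (niso_nat i g) /= => h.
by rewrite -[f]compm1 -[g]compm1 -(fwdK (niso i a)) !compA h.
Qed.

(** The preimage of g is G g, conjugated by the unit. *)
Lemma equivalence_bijective a b : bijective (@fmap _ _ _ E a b).
Proof.
pose u c : iso (G (E c)) c := niso unit_iso c.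
pose h g : hom a b := fwd (u b) \oc fmap G g \oc bwd (u a).
have G_inj x y : injective (@fmap _ _ _ G x y).
  by move=> f g fg; apply: (natiso_id_injective counit_iso); rewrite /= fg.
exists h => [f | g].
- have /= E1 := niso_nat unit_iso f.
  by rewrite /h E1 -compA fwdK compm1.
- apply: G_inj; have /= E1 := niso_nat unit_iso (h g).
  rewrite -[LHS](comp_bwdK (u b)) E1 /h -!compA bwdK compm1.
  by rewrite comp_bwdK.
Qed.

End EquivalenceFunctor.

Section EquivalenceMorita.

Variables (k : fieldType) (C : moncat k) (M N : modcat C) (X : M) (Y : N).
Hypothesis X_gen : is_cyclic_generator X.
Hypothesis Y_gen : is_cyclic_generator Y.

Lemma generator_span (P : modcat C) (U : P) : is_cyclic_generator U ->
  forall Z, exists r : seq {H : C & (hom Z (act H U) * hom (act H U) Z)%type},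
    \sum_(s <- r) (projT2 s).2 \oc (projT2 s).1 = idm Z.
Proof.
move=> U_gen Z.
have w1 (F : C) : exists r : seq unit, \sum_(t <- r) idm (act F U) = idm (act F U).
  by exists [:: tt]; rewrite big_seq1.
have [r rE] := generator_frames (w := fun F _ => idm (act F U)) U_gen w1 Z.
exists [seq existT (fun H : C => (hom Z (act H U) * hom (act H U) Z)%type)
  (fr_ob s) (fr_i s, fr_p s) | s <- r].
by rewrite big_map -rE; apply: eq_bigr => s _; rewrite compm1.
Qed.

Lemma equivalence_context :
  modcat_equivalent M N ->
  inhabited (morita_context (end_monoid X) (end_monoid Y)).
Proof.
move=> [Phi [G [[u] [v]]]].
have Phi_bij := equivalence_bijective u v.
apply: (context_of_orbits (image_rep X Phi_bij) (act_rep Y)) => F.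
  exact: (generator_span Y_gen).
have [r rE] := generator_span X_gen (G (act F Y)).
pose i := niso v (act F Y).
exists [seq existT (fun H : C => (hom (act F Y) (Phi (act H X)) *
                                  hom (Phi (act H X)) (act F Y))%type)
  (projT1 s) (fmap Phi (projT2 s).1 \oc bwd i, fwd i \oc fmap Phi (projT2 s).2)
  | s <- r].
have PhirE : \sum_(s <- r) fmap Phi ((projT2 s).2 \oc (projT2 s).1) =
    idm (Phi (G (act F Y))) by rewrite -linear_sum rE fmap_id.
transitivity (fwd i \oc (\sum_(s <- r) fmap Phi ((projT2 s).2 \oc (projT2 s).1)
    : hom (Phi (G (act F Y))) (Phi (G (act F Y)))) \oc bwd i).
  rewrite big_map comp_sumr comp_suml; apply: eq_bigr => s _ /=.
  by rewrite fmap_comp !compA.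
by rewrite PhirE compm1 fwdK.
Qed.

End EquivalenceMorita.

Theorem theorem3 (k : fieldType) (C : moncat k) (M N : modcat C)
    (M_cauchy : cauchy_complete M) (N_cauchy : cauchy_complete N)
    (X : M) (X_gen : is_cyclic_generator X)
    (Y : N) (Y_gen : is_cyclic_generator Y) :
  modcat_equivalent M N <->
  morita_equivalent (end_monoid X) (end_monoid Y).
Proof.
split=> [/(equivalence_context X_gen Y_gen) [c] | ].
  exact: context_morita_equivalent.
by move=> /morita_equivalent_context [c]; exact: (context_modcat_equivalent _ _ _ _ c).
Qed.
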